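(* Let $(A(\cdot),b(\cdot),b'(\cdot),c)$ be an explicit $s$-stage FCRKN method satisfying $$\sum_{i=1}^s b'_i(\alpha)=\alpha,\qquad \sum_{i=1}^s b_i(\alpha)=\frac{\alpha^2}{2}\qquad(\alpha\in[0,1]),$$ $$\sum_{j=1}^s a_{ij}(\alpha)=\frac{\alpha^2}{2}\qquad(\alpha\in[0,c_i],\ i=1,\dots,s),$$ and suppose the method is of uniform order three. Let $c^*_1<\dots<c^*_{s^*}$ be the distinct values among $c_1,\dots,c_s$. Assume that $f$ is of class $C^2$ with respect to the second argument and that the solution $u$ is of piecewise class $C^5$. Then the method is of uniform order four if and only if all of the following hold: $$\sum_{i=1}^s b'_i(\alpha)\,c_i^3=\frac{\alpha^4}{4},\qquad \alpha\in[0,1];$$ $$\sum_{\substack{i=1\\ c_i=c^*_m}}^s b'_i(\alpha)\left(\sum_{j=1}^s a_{ij}(\beta)\,c_j-\frac{\beta^3}{6}\right)=0,\qquad \alpha\in[0,1],\ \beta\in[0,c^*_m],\ m=1,\dots,s^*;$$ $$\sum_{i=1}^s b_i(\alpha)\,c_i^2=\frac{\alpha^4}{12},\qquad \alpha\in[0,1].$$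
   Context: Spaces. For $r\in[0,\infty]$, $\mathcal C$ is the space of continuous functions $[-r,0]\to\mathbb R^d$ with the maximum norm $\|\varphi\|=\max_{\theta\in[-r,0]}|\varphi(\theta)|$, where $|\cdot|$ is an arbitrary norm on $\mathbb R^d$; $\mathcal C^1$ is the analogous space of continuously differentiable functions. For a function $u$, $u_t(\theta)=u(t+\theta)$, $\theta\in[-r,0]$. Dots denote time derivatives; a prime on $b'$, $\eta'$, $E'$ is part of the name and does not mean differentiation. Problem. The second order retarded functional differential equation is $\ddot u(t)=f(t,u_t)$, where $u_t\in\mathcal C^1$, $f:\Omega\to\mathbb R^d$, $\Omega$ is an open subset of $\mathbb R\times\mathcal C^1$, $f$ is continuous and has a derivative $f':\Omega\to\mathcal L(\mathcal C^1,\mathbb R^d)$ with respect to the second argument (here the prime does mean derivative) which is bounded and continuous with respect to the second argument. For each $(\sigma,\varphi)\in\Omega$ there is a unique non-continuable solution $u:[\sigma-r,\bar t)\to\mathbb R^d$ through $(\sigma,\varphi)$, i.e. $u$ satisfies the equation for $t\in[\sigma,\bar t)$ and $u_\sigma=\varphi$. Since the right-hand side does not depend on $\dot u$, nothing further is required of $\dot\varphi$ except the existence of the initial value $\dot\varphi(0)$. Method. An explicit $s$-stage functional continuous Runge--Kutta--Nyström (FCRKN) method is a quadruple $(A(\cdot),b(\cdot),b'(\cdot),c)$, where $A(\cdot)=(a_{ij}(\cdot))$ is a strictly lower-triangular $\mathbb R^{s\times s}$-valued polynomial function with $A(0)=0$, $b(\cdot)=(b_i(\cdot))$ and $b'(\cdot)=(b'_i(\cdot))$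 are $\mathbb R^s$-valued polynomial functions with $b(0)=b'(0)=0$, and $c\in\mathbb R^s$ with $c_1=0$, $c_i\ge0$ for $i=2,\dots,s$. Applied with stepsize $h$ to get the solution $u$ through $(\sigma,\varphi)$, it gives for $\alpha\in[0,1]$ $$\eta(\alpha h)=\varphi(0)+\alpha h\dot\varphi(0)+h^2\sum_{i=1}^s b_i(\alpha)K_i,\qquad \eta'(\alpha h)=\dot\varphi(0)+h\sum_{i=1}^s b'_i(\alpha)K_i,$$ where $K_i=f(\sigma+c_ih,Y^i_{c_ih})$ and the stage functions $Y^i:[-r,c_ih]\to\mathbb R^d$ are given by $Y^i(\alpha h)=\varphi(0)+\alpha h\dot\varphi(0)+h^2\sum_{j=1}^{i-1}a_{ij}(\alpha)K_j$ for $\alpha\in[0,c_i]$ and $Y^i(\theta)=\varphi(\theta)$ for $\theta\in[-r,0]$. With $y=u(\sigma+\cdot)$, the local errors on $[0,h]$ are $E=\eta-y$ and $E'=\eta'-\dot y$. Order. The method has (local) uniform order $p$ if, for a sufficiently smooth problem $\ddot u(t)=f(t,u_t)$, for $h$ small enough there exist some $C>0$ and $C'>0$ such that $\max_{\alpha\in[0,1]}\|E(\alpha h)\|\le Ch^{p+1}$ and $\max_{\alpha\in[0,1]}\|E'(\alpha h)\|\le C'h^{p+1}$.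
   Formalization: Order is required only for u of piecewise class C^l, some l ≥ 5 depending on the method and the order, with f'' bounded and continuous in the second argument; for all piecewise C^5 solutions the ''if'' part fails (u'' = |t|^(7/2), where the error of u' is of size h^(9/2)). *)

(* Defs.v *)
From HB Require Import structures.
From mathcomp Require Import all_boot all_order all_algebra.
From mathcomp Require Import all_classical all_reals all_analysis.

Set Implicit Arguments.
Unset Strict Implicit.
Unset Printing Implicit Defensive.

Import Order.TTheory GRing.Theory Num.Theory.
Import numFieldNormedType.Exports.

Local Open Scope classical_set_scope.
Local Open Scope ring_scope.

Section Smoothness.
Variables (R : realType) (d : nat).
Implicit Types (D : set R) (g : R -> 'rV[R]_d).

(* One-sided at the end points of an interval D; vacuous if x is isolated in D. *)
Definition deriv_within D g (x : R) (l : 'rV[R]_d) : Prop :=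
  (y - x)^-1 *: (g y - g x) @[y --> within D x^'] --> l.

Definition classC (k : nat) D g : Prop :=
  exists w : nat -> R -> 'rV[R]_d,
    [/\ w 0%N = g,
        forall j x, (j < k)%N -> D x -> deriv_within D (w j) x (w j.+1 x)
      & {within D, continuous (w k)}].

(* Finitely many breakpoints on each compact subinterval; on the closed
   pieces between consecutive breakpoints g is C^k up to the end points. *)
Definition piecewiseC (k : nat) D g : Prop :=
  forall a b : R, `[a, b] `<=` D ->
  exists B : seq R, forall x y : R,
    a <= x -> x < y -> y <= b -> (forall z, z \in B -> ~ (x < z < y)) ->
    classC k `[x, y] g.

Definition is_norm (N : 'rV[R]_d -> R) : Prop :=
  [/\ forall x, N x = 0 -> x = 0,
      forall (a : R) x, N (a *: x) = `|a| * N x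
    & forall x y, N (x + y) <= N x + N y].

(* Histories are total functions of which only the values on [-r, 0] matter. *)
Definition hist_itv (r : \bar R) : set R :=
  [set th | (- r <= th%:E)%E /\ th <= 0].

(* For r = +oo the interval is the compact [-oo, 0]: continuity includes a
   limit at -oo, so the maximum of the norm exists and t |-> u_t is continuous. *)
Definition spaceC (r : \bar R) (phi : R -> 'rV[R]_d) : Prop :=
  {within hist_itv r, continuous phi} /\
  (r = +oo%E -> cvg (phi th @[th --> -oo])).

Definition spaceC1 (r : \bar R) (phi : R -> 'rV[R]_d) : Prop :=
  spaceC r phi /\ classC 1 (hist_itv r) phi.

End Smoothness.

(* Both spaces carry the maximum norm.  Stage functions lie in spaceC but have
   a corner at the initial time as soon as some a_ij has a linear term, in
   which case they are not in spaceC1; phaseC is there to accommodate them. *)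
Inductive phase_space := phaseC | phaseC1.

Definition in_phase (X : phase_space) (R : realType) (d : nat) (r : \bar R)
    (phi : R -> 'rV[R]_d) : Prop :=
  match X with phaseC => spaceC r phi | phaseC1 => spaceC1 r phi end.

Record rfde (R : realType) := Rfde {
  rdim : nat;
  vnorm : 'rV[R]_rdim -> R;
  delay : \bar R;
  rdom : set (R * (R -> 'rV[R]_rdim));
  rhs : R -> (R -> 'rV[R]_rdim) -> 'rV[R]_rdim }.

Arguments rdom {R} _ _.
Arguments vnorm {R} _ _.
Arguments rhs {R} _ _ _.

Section Problem.
Variables (R : realType) (X : phase_space) (P : rfde R).

Let V := 'rV[R]_(rdim P).
Let H := R -> V.
Let phase : H -> Prop := in_phase X (delay P).

(* The supremum is a maximum on spaceC. *)
Definition hnorm (phi : H) : R :=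
  sup [set vnorm P (phi th) | th in hist_itv (delay P)].

Definition segment (u : H) (t : R) : H := fun th => u (t + th).

(* Openness and continuity are with respect to the seminorm hnorm, so the
   domain and the right-hand side depend on histories only through their
   restriction to [-r, 0]. *)
Definition dom_open : Prop :=
  forall t psi, rdom P (t, psi) -> phase psi /\
    exists2 e : R, 0 < e & forall t' psi', phase psi' ->
      `|t' - t| < e -> hnorm (psi' - psi) < e -> rdom P (t', psi').

Definition rhs_continuous : Prop :=
  forall t psi, rdom P (t, psi) -> forall e : R, 0 < e ->
    exists2 del : R, 0 < del & forall t' psi', rdom P (t', psi') ->
      `|t' - t| < del -> hnorm (psi' - psi) < del ->
      vnorm P (rhs P t' psi' - rhs P t psi) < e.

Definition phase_linear (T : H -> V) : Prop :=
  forall (a : R) chi1 chi2, phase chi1 -> phase chi2 ->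
    T (a *: chi1 + chi2) = a *: T chi1 + T chi2.

(* Frechet derivative with respect to the second argument. *)
Definition is_deriv1 (Df : R -> H -> H -> V) : Prop :=
  forall t psi, rdom P (t, psi) -> phase_linear (Df t psi) /\
    forall e : R, 0 < e -> exists2 del : R, 0 < del &
      forall chi, phase chi -> hnorm chi < del -> rdom P (t, psi + chi) ->
      vnorm P (rhs P t (psi + chi) - rhs P t psi - Df t psi chi)
        <= e * hnorm chi.

Definition bounded1 (Df : R -> H -> H -> V) : Prop :=
  exists M : R, forall t psi, rdom P (t, psi) -> forall chi, phase chi ->
    vnorm P (Df t psi chi) <= M * hnorm chi.

Definition continuous1 (Df : R -> H -> H -> V) : Prop :=
  forall t psi, rdom P (t, psi) -> forall e : R, 0 < e ->
    exists2 del : R, 0 < del & forall psi', rdom P (t, psi') ->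
      hnorm (psi' - psi) < del -> forall chi, phase chi ->
      vnorm P (Df t psi' chi - Df t psi chi) <= e * hnorm chi.

(* D2f t psi is the derivative of psi |-> Df t psi in the operator norm, as a
   bilinear map. *)
Definition is_deriv2 (Df : R -> H -> H -> V) (D2f : R -> H -> H -> H -> V)
    : Prop :=
  forall t psi, rdom P (t, psi) ->
    [/\ forall chi1, phase chi1 -> phase_linear (D2f t psi chi1),
        forall chi2, phase chi2 -> phase_linear (fun chi1 => D2f t psi chi1 chi2)
      & forall e : R, 0 < e -> exists2 del : R, 0 < del &
          forall chi1, phase chi1 -> hnorm chi1 < del ->
          rdom P (t, psi + chi1) -> forall chi2, phase chi2 ->
          vnorm P (Df t (psi + chi1) chi2 - Df t psi chi2
                   - D2f t psi chi1 chi2) <= e * hnorm chi1 * hnorm chi2].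

Definition bounded2 (D2f : R -> H -> H -> H -> V) : Prop :=
  exists M : R, forall t psi, rdom P (t, psi) ->
    forall chi1 chi2, phase chi1 -> phase chi2 ->
    vnorm P (D2f t psi chi1 chi2) <= M * hnorm chi1 * hnorm chi2.

Definition continuous2 (D2f : R -> H -> H -> H -> V) : Prop :=
  forall t psi, rdom P (t, psi) -> forall e : R, 0 < e ->
    exists2 del : R, 0 < del & forall psi', rdom P (t, psi') ->
      hnorm (psi' - psi) < del ->
      forall chi1 chi2, phase chi1 -> phase chi2 ->
      vnorm P (D2f t psi' chi1 chi2 - D2f t psi chi1 chi2)
        <= e * hnorm chi1 * hnorm chi2.

Definition rfde_problem : Prop :=
  [/\ (0 <= delay P)%E, is_norm (vnorm P), dom_open, rhs_continuous
    & exists Df, [/\ is_deriv1 Df, bounded1 Df & continuous1 Df]].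

(* As for the first derivative, the second one is required to be bounded and
   continuous with respect to the second argument. *)
Definition rhs_C2 : Prop :=
  exists Df D2f,
    [/\ is_deriv1 Df, bounded1 Df & continuous1 Df] /\
    [/\ is_deriv2 Df D2f, bounded2 D2f & continuous2 D2f].

Definition sol_itv (sigma : R) (tbar : \bar R) : set R :=
  [set t | sigma <= t /\ (t%:E < tbar)%E].

Definition full_itv (sigma : R) (tbar : \bar R) : set R :=
  [set t | (sigma%:E - delay P <= t%:E)%E /\ (t%:E < tbar)%E].

(* v0 is the initial value of the derivative of phi: its left derivative at 0
   if the delay is positive, and free data if the delay is zero, where the
   derivative condition is vacuous. *)
Definition initial_data (sigma : R) (phi : H) (v0 : V) : Prop :=
  rdom P (sigma, phi) /\ deriv_within (hist_itv (delay P)) phi 0 v0.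

(* u is a solution on [sigma - r, tbar) and v its derivative on [sigma, tbar). *)
Definition is_solution (sigma : R) (phi : H) (v0 : V) (tbar : \bar R)
    (u v : H) : Prop :=
  [/\ (sigma%:E < tbar)%E,
      forall th, hist_itv (delay P) th -> u (sigma + th) = phi th,
      v sigma = v0
    & forall t, sol_itv sigma tbar t ->
        [/\ rdom P (t, segment u t),
            deriv_within (sol_itv sigma tbar) u t (v t)
          & deriv_within (sol_itv sigma tbar) v t (rhs P t (segment u t))]].

Definition noncontinuable (sigma : R) (phi : H) (v0 : V) (tbar : \bar R)
    (u : H) : Prop :=
  forall tbar' u' v', (tbar < tbar')%E ->
    is_solution sigma phi v0 tbar' u' v' ->
    ~ (forall t, sol_itv sigma tbar t -> u' t = u t).

End Problem.

Section Method.
Variables (R : realType) (s : nat).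
Variables (A : 'M[{poly R}]_s) (b b' : 'I_s -> {poly R}) (c : 'I_s -> R).

Definition explicit_fcrkn : Prop :=
  [/\ forall i j : 'I_s, (i <= j)%N -> A i j = 0,
      forall i j, (A i j).[0] = 0,
      forall i, (b i).[0] = 0 /\ (b' i).[0] = 0,
      forall i : 'I_s, i = 0%N :> nat -> c i = 0
    & forall i, 0 <= c i].

Section Step.
Variables (P : rfde R) (sigma : R) (phi : R -> 'rV[R]_(rdim P)).
Variables (v0 : 'rV[R]_(rdim P)) (h : R) (K : 'I_s -> 'rV[R]_(rdim P)).

Definition stage (i : 'I_s) (x : R) : 'rV[R]_(rdim P) :=
  if x <= 0 then phi x
  else phi 0 + x *: v0
       + h ^+ 2 *: \sum_(j < s | (j < i)%N) (A i j).[x / h] *: K j.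

(* The method is applicable with stepsize h and K are its stage values. *)
Definition is_stages : Prop :=
  forall i, rdom P (sigma + c i * h, segment (stage i) (c i * h)) /\
            K i = rhs P (sigma + c i * h) (segment (stage i) (c i * h)).

Definition eta (alpha : R) : 'rV[R]_(rdim P) :=
  phi 0 + (alpha * h) *: v0 + h ^+ 2 *: \sum_i (b i).[alpha] *: K i.

Definition eta' (alpha : R) : 'rV[R]_(rdim P) :=
  v0 + h *: \sum_i (b' i).[alpha] *: K i.

End Step.

Definition local_error_bound (P : rfde R) (sigma : R)
    (phi : R -> 'rV[R]_(rdim P)) (v0 : 'rV[R]_(rdim P))
    (u v : R -> 'rV[R]_(rdim P)) (p : nat) : Prop :=
  exists h0 C C' : R, [/\ 0 < h0, 0 < C, 0 < C'
    & forall h, 0 < h -> h <= h0 ->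
      exists2 K, is_stages sigma phi v0 h K &
      forall alpha, 0 <= alpha <= 1 ->
        vnorm P (eta phi v0 h K alpha - u (sigma + alpha * h)) <= C * h ^+ p.+1
        /\ vnorm P (eta' v0 h K alpha - v (sigma + alpha * h))
             <= C' * h ^+ p.+1].

(* Uniform order p among the problems with rhs of class C^2 with respect to the
   second argument and solution of piecewise class C^l0, for sufficiently
   smooth ones: the solution is piecewise C^l for some threshold l >= l0
   depending on the method and p only.  A threshold l = l0 = 5 would be too
   low for p = 4: for u'' = t^(7/2), where u is C^5, the error of u' on [0, h]
   is h^(9/2) times a nonzero function of alpha, whatever the method. *)
Definition uniform_order (X : phase_space) (l0 p : nat) : Prop :=
  exists2 l : nat, (l0 <= l)%N &
    forall (P : rfde R), rfde_problem X P -> rhs_C2 X P ->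
    forall (sigma : R) (phi : R -> 'rV[R]_(rdim P)) (v0 : 'rV[R]_(rdim P))
           (tbar : \bar R) (u v : R -> 'rV[R]_(rdim P)),
      initial_data sigma phi v0 ->
      is_solution sigma phi v0 tbar u v ->
      noncontinuable sigma phi v0 tbar u ->
      piecewiseC l (full_itv P sigma tbar) u ->
      local_error_bound sigma phi v0 u v p.

End Method.

(* Main.v *)
Require Import Defs.
From HB Require Import structures.
From mathcomp Require Import all_boot all_order all_algebra.
From mathcomp Require Import all_classical all_reals all_analysis.
From mathcomp Require Import ring lra.

(** On an interval to the right of the initial time sigma the solution u is
    smooth, and the numerical solution is compared there with the Taylor
    polynomials of u at sigma.  For a step size h let t_i = sigma + c_i h, let
    e_i be the error of the i-th stage function, and let
    G_i(x) = sum_j a_ij(x) c_j - x^3 / 6.  The condition on sum_j a_ij(x) gives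

      e_i(x h) = h^3 G_i(x) u'''(sigma) + O(h^4).

    Since f is twice differentiable, with bounded derivatives, on a tube of
    uniform radius around the segments u_t with t close to sigma,

      K_i - u''(t_i) = f'(t_i, u_{t_i}) e_i + O(h^6).

    Therefore, with u^(j) standing for the j-th derivative at sigma,

      E'(alpha h) = sum_(k < 4) h^(k+1) / k!
                      (sum_i b'_i(alpha) c_i^k - alpha^(k+1) / (k+1)) u^(k+2)
                    + h sum_i b'_i(alpha) f'(t_i, u_{t_i}) e_i + O(h^5).

    The expansion of E has h^2, b_i and alpha^(k+2) / ((k+1) (k+2)) in place of
    h, b'_i and alpha^(k+1) / (k+1); its term in k = 3 and its last sum, of size
    h^2 h^3, are already negligible.

    Sufficiency ([order_four_bound]).  The moments vanish by the order three
    and the first and third conditions.  Stages with the same abscissa share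
    the functional f'(t_i, u_{t_i}), so their contribution is the value of that
    functional at the sum of the b'_i(alpha) e_i over these stages, a function
    of size O(h^4) by the second condition ([weighted_defect]).  The dependence
    of f' on t never has to be expanded.  Applicability of the method with
    small step sizes comes with the order three.

    Necessity ([moment_conditions], [stage_condition]).  The problems
    u'' = t^k give the quadrature conditions.  For the second condition the
    problem is

      u''(t) = t + w(t) (chi(-(1-q) t) - chi(-t)),   chi = u_t - (t + .)^3 / 6,

    for t in [0, 1], whose solution is t^3 / 6 for any gate w and for which
    K_i = c_i h + w(c_i h) e_i(q c_i h).  With a gate that has a limit at 0 one
    would only see a sum over all the abscissae.  However, f has to be
    continuous in t and its derivative with respect to the history does not, so
    that w may oscillate near 0: a gate periodic in log t ([gate_exists])
    isolates one abscissa c*_m along a sequence of step sizes tending to 0, and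
    q = beta / c*_m then gives the condition at beta. *)

Import Order.TTheory GRing.Theory Num.Theory.
Import numFieldNormedType.Exports.

Local Open Scope classical_set_scope.
Local Open Scope ring_scope.

Set Implicit Arguments.
Unset Strict Implicit.
Unset Printing Implicit Defensive.

(** * Norms on row vectors and the mean value inequality *)

Section NormOnRows.
Variables (R : realType) (d : nat) (N : 'rV[R]_d -> R).
Hypothesis hN : is_norm N.
Implicit Types (g : R -> 'rV[R]_d) (D : set R).

Lemma normD (x y : 'rV[R]_d) : N (x + y) <= N x + N y.
Proof. by case: hN. Qed.

Lemma normZ (a : R) (x : 'rV[R]_d) : N (a *: x) = `|a| * N x.
Proof. by case: hN. Qed.

Lemma norm0 : N 0 = 0.
Proof. by rewrite -(scale0r 0) normZ normr0 mul0r. Qed.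

Lemma norm0_eq0 (x : 'rV[R]_d) : N x = 0 -> x = 0.
Proof. by case: hN => h _ _; exact: h. Qed.

Lemma normN (x : 'rV[R]_d) : N (- x) = N x.
Proof. by rewrite -scaleN1r normZ normrN1 mul1r. Qed.

Lemma norm_ge0 (x : 'rV[R]_d) : 0 <= N x.
Proof.
have := normD x (- x); rewrite subrr norm0 normN -mulr2n.
by rewrite pmulrn_lge0.
Qed.

Lemma normB (x y : 'rV[R]_d) : N (x - y) <= N x + N y.
Proof. by rewrite -[in leRHS](normN y) normD. Qed.

Lemma normC (x y : 'rV[R]_d) : N (x - y) = N (y - x).
Proof. by rewrite -normN opprB. Qed.

Lemma norm_sum (I : Type) (r : seq I) (Q : pred I) (F : I -> 'rV[R]_d) :
  N (\sum_(i <- r | Q i) F i) <= \sum_(i <- r | Q i) N (F i).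
Proof.
elim/big_ind2: _ => [||//]; first by rewrite norm0.
by move=> x1 x2 y1 y2 h1 h2; exact: le_trans (normD _ _) (lerD h1 h2).
Qed.

Lemma normZ_le (a B B' : R) (x : 'rV[R]_d) :
  `|a| <= B' -> N x <= B -> N (a *: x) <= B' * B.
Proof. by move=> ha hx; rewrite normZ ler_pM ?norm_ge0. Qed.

(** The hypotheses on the solution are topological and the conclusions are
    bounds in the given norm, so estimates only travel in this direction. *)
Lemma norm_le_mxnorm : exists2 C : R, 0 < C & forall x, N x <= C * `|x|.
Proof.
exists (1 + \sum_(j < d) N (delta_mx 0 j)).
  by rewrite ltr_wpDr// sumr_ge0// => j _; exact: norm_ge0.
move=> x; rewrite mulrDl mul1r ler_wpDl// mulr_suml.
rewrite {1}(row_sum_delta x).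
apply: le_trans (norm_sum _ _ _) _; apply: ler_sum => j _.
rewrite normZ mulrC ler_wpM2l ?norm_ge0//.
rewrite [`|x|]mx_normrE.
by apply: (@le_bigmax _ _ _ _ (fun ij : 'I_1 * 'I_d => `|x ij.1 ij.2|) (0, j)).
Qed.

(** Differentiability relative to [D], in the given norm and in a form that
    avoids quotients. *)
Definition has_deriv D g (x : R) (l : 'rV[R]_d) : Prop :=
  forall e : R, 0 < e -> exists2 del : R, 0 < del & forall y, D y ->
    `|y - x| < del -> N (g y - g x - (y - x) *: l) <= e * `|y - x|.

Lemma has_derivS D D' g x l :
  D' `<=` D -> has_deriv D g x l -> has_deriv D' g x l.
Proof.
move=> sD hg e e0; have [del del0 hd] := hg e e0.
by exists del => // y Dy; apply: hd; exact: sD.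
Qed.

Lemma has_deriv_ext D g g' x l :
  D x -> (forall y, D y -> g y = g' y) -> has_deriv D g x l ->
  has_deriv D g' x l.
Proof.
move=> Dx gg hg e e0; have [del del0 hd] := hg e e0.
by exists del => // y Dy yx; rewrite -!gg//; exact: hd.
Qed.

Lemma has_derivD D g g' x l l' : has_deriv D g x l -> has_deriv D g' x l' ->
  has_deriv D (fun t => g t + g' t) x (l + l').
Proof.
move=> hg hg' e e0; have e2 : 0 < e / 2 by lra.
have [a a0 ha] := hg _ e2; have [b b0 hb] := hg' _ e2.
exists (Order.min a b); first by rewrite lt_min a0.
move=> y Dy; rewrite lt_min => /andP[ya yb].
have -> : g y + g' y - (g x + g' x) - (y - x) *: (l + l') =
  (g y - g x - (y - x) *: l) + (g' y - g' x - (y - x) *: l').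
  by apply/rowP => j; rewrite !mxE; ring.
apply: le_trans (normD _ _) _.
by have := ha y Dy ya; have := hb y Dy yb; lra.
Qed.

Lemma has_derivN D g x l : has_deriv D g x l ->
  has_deriv D (fun t => - g t) x (- l).
Proof.
move=> hg e e0; have [a a0 ha] := hg _ e0; exists a => // y Dy ya.
by rewrite scalerN -!opprD normN; exact: ha.
Qed.

Lemma has_deriv_cst D x (v : 'rV[R]_d) : has_deriv D (fun=> v) x 0.
Proof.
move=> e e0; exists 1 => // y _ _.
by rewrite subrr scaler0 subr0 norm0 mulr_ge0// ltW.
Qed.

Lemma has_deriv_sum D (I : Type) (r : seq I) (g : I -> R -> 'rV[R]_d) x
    (l : I -> 'rV[R]_d) : (forall i, has_deriv D (g i) x (l i)) ->
  has_deriv D (fun t => \sum_(i <- r) g i t) x (\sum_(i <- r) l i).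
Proof.
move=> h; elim: r => [|i r IH].
  rewrite big_nil; have -> : (fun t => \sum_(i <- [::]) g i t) = (fun=> 0).
    by apply/funext => t; rewrite big_nil.
  exact: has_deriv_cst.
rewrite big_cons.
have -> : (fun t => \sum_(i <- i :: r) g i t) =
    (fun t => g i t + \sum_(i <- r) g i t).
  by apply/funext => t; rewrite big_cons.
exact: has_derivD.
Qed.

(** Two derivatives would differ, in norm, by less than any positive number: at
    every point of the interval there are distinct points of it arbitrarily
    close. *)
Lemma has_deriv_uniq (a b x : R) g l l' : a < b -> a <= x <= b ->
  has_deriv `[a, b]%classic g x l -> has_deriv `[a, b]%classic g x l' -> l = l'.
Proof.
move=> ab /andP[ax xb] hl hl'.
apply/eqP; rewrite -subr_eq0; apply/eqP; apply: norm0_eq0.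
apply/eqP; rewrite eq_le norm_ge0 andbT; apply/ler_addgt0Pr => e e0.
rewrite add0r; have e2 : 0 < e / 2 by lra.
have [p p0 hp] := hl _ e2; have [q q0 hq] := hl' _ e2.
have [y [ay yb yx yp yq]] : exists y, [/\ a <= y, y <= b, 0 < `|y - x|,
    `|y - x| < p & `|y - x| < q].
  case: (ltP x b) => [xb'|bx].
    exists (x + Order.min (b - x) (Order.min (p / 2) (q / 2))).
    have h0 : 0 < Order.min (b - x) (Order.min (p / 2) (q / 2)).
      by rewrite !lt_min subr_gt0 xb' !divr_gt0.
    have h1 : Order.min (b - x) (Order.min (p / 2) (q / 2)) <= b - x.
      by rewrite ge_min lexx.
    have h2 : Order.min (b - x) (Order.min (p / 2) (q / 2)) <= p / 2.
      by rewrite !ge_min lexx !orbT.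
    have h3 : Order.min (b - x) (Order.min (p / 2) (q / 2)) <= q / 2.
      by rewrite !ge_min lexx !orbT.
    by rewrite addrAC subrr add0r gtr0_norm//; split; lra.
  exists (x - Order.min (b - a) (Order.min (p / 2) (q / 2))).
  have h0 : 0 < Order.min (b - a) (Order.min (p / 2) (q / 2)).
    by rewrite !lt_min subr_gt0 ab !divr_gt0.
  have h1 : Order.min (b - a) (Order.min (p / 2) (q / 2)) <= b - a.
    by rewrite ge_min lexx.
  have h2 : Order.min (b - a) (Order.min (p / 2) (q / 2)) <= p / 2.
    by rewrite !ge_min lexx !orbT.
  have h3 : Order.min (b - a) (Order.min (p / 2) (q / 2)) <= q / 2.
    by rewrite !ge_min lexx !orbT.
  by rewrite addrAC subrr add0r normrN gtr0_norm//; split; lra.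
have Dy : `[a, b]%classic y by rewrite /= in_itv /= ay yb.
have h1 := hp y Dy yp; have h2 := hq y Dy yq.
rewrite -(ler_pM2l yx) -normZ.
have -> : (y - x) *: (l - l') =
    (g y - g x - (y - x) *: l') - (g y - g x - (y - x) *: l).
  by apply/rowP => j; rewrite !mxE; ring.
apply: le_trans (normB _ _) _.
by rewrite [leRHS]mulrC; lra.
Qed.

(** The mean value inequality in terms of pointwise Lipschitz constants instead
    of derivatives: in this form it serves curves in the state space and curves
    of values of the right-hand side alike. *)
Lemma mean_value_ineq g (a b M : R) : a <= b ->
  (forall x, a <= x <= b -> forall e : R, 0 < e -> exists2 del : R, 0 < del &
     forall y, a <= y <= b -> `|y - x| < del ->
     N (g y - g x) <= (M + e) * `|y - x|) ->
  N (g b - g a) <= M * (b - a).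
Proof.
move=> ab hg.
suff main e : 0 < e -> N (g b - g a) <= (M + e) * (b - a).
  apply/ler_addgt0Pr => e e0.
  have d0 : 0 < b - a + 1 by lra.
  have := main (e / (b - a + 1)) (divr_gt0 e0 d0).
  rewrite mulrDl => /le_trans; apply; rewrite lerD2l.
  by rewrite mulrAC ler_pdivrMr//; apply: ler_wpM2l; lra.
move=> e0.
(* The set of the points reached by the estimate contains its supremum, which
   can only be b. *)
pose S : set R := [set x | a <= x <= b /\ N (g x - g a) <= (M + e) * (x - a)].
have Sa : S a by rewrite /S /= lexx ab !subrr norm0 mulr0.
have hS : has_sup S.
  by split; [exists a|exists b => x [/andP[]]].
set c := sup S.
have ac : a <= c by apply: ub_le_sup => //; case: hS.
have cb : c <= b.
  by apply: ge_sup; [exists a|move=> x [/andP[]]].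
have cab : a <= c <= b by rewrite ac cb.
have [del del0 hd] := hg c cab e e0.
have Sc : N (g c - g a) <= (M + e) * (c - a).
  have [x Sx cx] := sup_adherent del0 hS; rewrite -/c in cx.
  have xc : x <= c by apply: ub_le_sup => //; case: hS.
  case: Sx => xab hx.
  have xc1 : `|x - c| < del by rewrite distrC ger0_norm; lra.
  have := hd x xab xc1; rewrite distrC ger0_norm ?subr_ge0// normC => h1.
  have -> : g c - g a = (g c - g x) + (g x - g a) by rewrite addrA subrK.
  by apply: le_trans (normD _ _) _; lra.
have [bc|cltb] := leP b c; first by have -> : b = c by lra.
set y := c + Order.min (del / 2) (b - c).
have m0 : 0 < Order.min (del / 2) (b - c).
  by rewrite lt_min divr_gt0//= subr_gt0.
have m1 : Order.min (del / 2) (b - c) <= del / 2 by rewrite ge_min lexx.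
have m2 : Order.min (del / 2) (b - c) <= b - c by rewrite ge_min lexx orbT.
have yab : a <= y <= b by rewrite /y; apply/andP; split; lra.
have yc : y - c = Order.min (del / 2) (b - c) by rewrite /y addrAC subrr add0r.
have yc1 : `|y - c| < del by rewrite yc gtr0_norm//; lra.
have := hd y yab yc1; rewrite yc gtr0_norm// -yc => h1.
suff Sy : S y.
  have : y <= c by apply: ub_le_sup => //; case: hS.
  by lra.
split => //.
have -> : g y - g a = (g y - g c) + (g c - g a) by rewrite addrA subrK.
by apply: le_trans (normD _ _) _; lra.
Qed.

End NormOnRows.

(** * Derivatives and continuity in terms of norms *)

Lemma is_norm_mxnorm (R : realType) (d : nat) :
  @is_norm R d (fun x => `|x|).
Proof.
split=> [x /eqP|a x|x y]; first by rewrite normr_eq0 => /eqP.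
- exact: mx_normZ.
- exact: ler_normD.
Qed.

Section Topology.
Variables (R : realType) (d : nat).
Implicit Types (g : R -> 'rV[R]_d) (D : set R).

Lemma deriv_withinP D g (x : R) (l : 'rV[R]_d) :
  deriv_within D g x l <-> has_deriv (fun v => `|v|) D g x l.
Proof.
have quotient (y : R) : y != x -> forall e : R,
    (`|g y - g x - (y - x) *: l| <= e * `|y - x|) =
    (`|l - (y - x)^-1 *: (g y - g x)| <= e).
  move=> yx e; have yx0 : y - x != 0 by rewrite subr_eq0.
  have -> : g y - g x - (y - x) *: l =
      (y - x) *: ((y - x)^-1 *: (g y - g x) - l).
    by rewrite scalerBr scalerA mulfV// scale1r.
  by rewrite normrZ mulrC ler_pM2r ?normr_gt0// distrC.
rewrite /deriv_within; split.
  move=> /cvgrPdist_le h e e0; have := h e e0.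
  rewrite near_withinE /dnbhs near_withinE => /nbhs_ballP[del /= del0 hd].
  exists del => // y Dy yx; have [->|yNx] := eqVneq y x.
    by rewrite !subrr scale0r subrr !normr0 mulr0.
  by rewrite quotient//; apply: hd => //=; rewrite /ball /= distrC.
move=> h; apply/cvgrPdist_le => e e0; have [del del0 hd] := h e e0.
rewrite near_withinE /dnbhs near_withinE; apply/nbhs_ballP; exists del => //.
move=> y /=; rewrite /ball /= distrC => yx yNx Dy.
by rewrite -quotient//; apply: hd.
Qed.

Lemma continuous_withinP D g : {within D, continuous g} <->
  forall x, D x -> forall e : R, 0 < e -> exists2 del : R, 0 < del &
    forall y, D y -> `|y - x| < del -> `|g y - g x| <= e.
Proof.
rewrite subspace_continuousP; split=> h x Dx.
  have /cvgrPdist_le {}h := h x Dx.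
  move=> e e0; have := h e e0.
  rewrite near_withinE => /nbhs_ballP[del /= del0 hd]; exists del => // y Dy yx.
  by rewrite distrC; apply: hd => //=; rewrite /ball /= distrC.
apply/cvgrPdist_le => e e0; have [del del0 hd] := h x Dx e e0.
rewrite near_withinE; apply/nbhs_ballP; exists del => // y /=.
by rewrite /ball /= distrC => yx Dy; rewrite distrC; apply: hd.
Qed.

Lemma has_deriv_continuous D g (l : R -> 'rV[R]_d) :
  (forall x, D x -> deriv_within D g x (l x)) -> {within D, continuous g}.
Proof.
move=> hg; apply/continuous_withinP => x Dx e e0.
have /deriv_withinP/(_ 1 ltr01)[del del0 hd] := hg x Dx.
have L0 : 0 < 1 + `|l x| by have := normr_ge0 (l x); lra.
exists (Order.min del (e / (1 + `|l x|))); first by rewrite lt_min del0 divr_gt0.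
move=> y Dy; rewrite lt_min => /andP[yd]; rewrite ltr_pdivlMr// => ye.
have := hd y Dy yd; rewrite mul1r => h1.
have -> : g y - g x = (g y - g x - (y - x) *: l x) + (y - x) *: l x.
  by rewrite subrK.
by apply: le_trans (ler_normD _ _) _; rewrite normrZ; lra.
Qed.

Lemma classC_le (k k' : nat) D g : (k' <= k)%N -> classC k D g -> classC k' D g.
Proof.
move=> kk [w [w0 wd wc]]; exists w; split => //.
  by move=> j x jk; apply: wd; exact: leq_trans kk.
move: kk; rewrite leq_eqVlt => /orP[/eqP->//|kk].
by apply: (@has_deriv_continuous _ _ (w k'.+1)) => x; exact: wd.
Qed.

Lemma piecewiseC_le (k k' : nat) D g :
  (k' <= k)%N -> piecewiseC k D g -> piecewiseC k' D g.
Proof.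
move=> kk h a b abD; have [B hB] := h a b abD; exists B => x y ax xy yb hz.
by apply: classC_le kk _; exact: hB.
Qed.

Lemma continuous_bounded (a b : R) g : {within `[a, b], continuous g} ->
  exists2 M : R, 0 <= M & forall x, a <= x <= b -> `|g x| <= M.
Proof.
move=> cg.
have /compact_bounded := @continuous_compact _ _ g _ cg (@segment_compact _ a b).
move=> [M [Mr hM]]; exists (`|M| + 1); first by have := normr_ge0 M; lra.
move=> x xab; apply: (hM (`|M| + 1)) => /=.
  by have := ler_norm M; lra.
by exists x => //; rewrite /= in_itv.
Qed.

Variable (N : 'rV[R]_d -> R).
Hypothesis hN : is_norm N.

Lemma deriv_within_norm D g (x : R) (l : 'rV[R]_d) :
  deriv_within D g x l -> has_deriv N D g x l.
Proof.
have [C C0 hC] := norm_le_mxnorm hN.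
move=> /deriv_withinP h e e0; have [del del0 hd] := h _ (divr_gt0 e0 C0).
exists del => // y Dy yx; apply: le_trans (hC _) _.
have := ler_wpM2l (ltW C0) (hd y Dy yx).
by rewrite mulrA [C * (e / C)]mulrC divfK// gt_eqF.
Qed.

Lemma continuous_bounded_norm (a b : R) g : {within `[a, b], continuous g} ->
  exists2 M : R, 0 <= M & forall x, a <= x <= b -> N (g x) <= M.
Proof.
have [C C0 hC] := norm_le_mxnorm hN.
move=> /continuous_bounded[M M0 hM]; exists (C * M); first by rewrite mulr_ge0// ltW.
by move=> x xab; apply: le_trans (hC _) _; rewrite ler_pM2l// hM.
Qed.

End Topology.

Section Polynomials.
Variable R : realType.
Implicit Types p : {poly R}.

Lemma poly_bounded p (B : R) : 0 <= B ->
  exists2 M : R, 0 <= M & forall x, `|x| <= B -> `|p.[x]| <= M.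
Proof.
move=> B0; elim/poly_ind: p => [|p a [M M0 hM]].
  by exists 0 => // x _; rewrite horner0 normr0.
exists (M * B + `|a|); first by rewrite addr_ge0 ?mulr_ge0.
move=> x xB; rewrite hornerMXaddC; apply: le_trans (ler_normD _ _) _.
by rewrite lerD2r normrM ler_pM// hM.
Qed.

Lemma poly_family_bounded (I : finType) (p : I -> {poly R}) (B : R) : 0 <= B ->
  exists2 M : R, 0 <= M & forall i x, `|x| <= B -> `|(p i).[x]| <= M.
Proof.
move=> B0.
have /choice[M hM] i : exists M : R, 0 <= M /\
    forall x, `|x| <= B -> `|(p i).[x]| <= M.
  by have [M M0 h] := poly_bounded (p i) B0; exists M.
exists (\sum_i M i); first by apply: sumr_ge0 => i _; have [] := hM i.
move=> i x xB; rewrite (bigD1 i)//= ler_wpDr//; last by have [_] := hM i; apply.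
by apply: sumr_ge0 => j _; have [] := hM j.
Qed.

Variables (d : nat) (N : 'rV[R]_d -> R).
Hypothesis hN : is_norm N.

(** Stated for polynomials because both the Taylor sums and the solutions of
    the test problems are polynomial in time. *)
Lemma has_deriv_poly D p (v : 'rV[R]_d) (x : R) :
  has_deriv N D (fun t => p.[t] *: v) x (p^`().[x] *: v).
Proof.
(* Two divisions by X - x give p(y) - p(x) - (y-x) p'(x) = (y-x)^2 r(y). *)
have [q hq] : exists q, p = q * ('X - x%:P) + p.[x]%:P.
  have /factor_theorem[q hq] : root (p - p.[x]%:P) x.
    by rewrite /root !hornerE subrr.
  by exists q; rewrite -hq subrK.
have [r hr] : exists r, q = r * ('X - x%:P) + q.[x]%:P.
  have /factor_theorem[r hr] : root (q - q.[x]%:P) x.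
    by rewrite /root !hornerE subrr.
  by exists r; rewrite -hr subrK.
have hqx : p^`().[x] = q.[x].
  rewrite {1}hq derivD derivM derivXsubC derivC addr0 mulr1 hornerD hornerM.
  by rewrite hornerXsubC subrr mulr0 add0r.
have py y : p.[y] = q.[y] * (y - x) + p.[x] by rewrite {1}hq !hornerE.
have qy y : q.[y] = r.[y] * (y - x) + q.[x] by rewrite {1}hr !hornerE.
have B0 : 0 <= `|x| + 1 by have := normr_ge0 x; lra.
have [M M0 hM] := poly_bounded r B0.
move=> e e0; have K0 : 0 < M * N v + 1 by rewrite ltr_wpDl// mulr_ge0// norm_ge0.
exists (Order.min 1 (e / (M * N v + 1))); first by rewrite lt_min ltr01 divr_gt0.
move=> y _; rewrite lt_min => /andP[y1]; rewrite ltr_pdivlMr// => ye.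
have -> : p.[y] *: v - p.[x] *: v - (y - x) *: (p^`().[x] *: v) =
    (y - x) *: ((y - x) *: (r.[y] *: v)).
  by apply/rowP => j; rewrite !mxE hqx py qy; ring.
rewrite !(normZ hN) mulrC; apply: ler_wpM2r => //.
have ry : `|r.[y]| <= M.
  apply: hM; have -> : y = x + (y - x) by ring.
  by apply: le_trans (ler_normD _ _) _; lra.
apply: le_trans (ltW ye); apply: ler_wpM2l => //.
apply: (@le_trans _ _ (M * N v)); last by lra.
by apply: ler_wpM2r => //; exact: norm_ge0.
Qed.

End Polynomials.

(** * Taylor's formula *)

Section Taylor.
Variables (R : realType) (d : nat) (N : 'rV[R]_d -> R).
Hypothesis hN : is_norm N.

Lemma mean_value_ineq_deriv (g l : R -> 'rV[R]_d) (a b M : R) : a <= b ->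
  (forall x, a <= x <= b -> has_deriv N `[a, b]%classic g x (l x)) ->
  (forall x, a <= x <= b -> N (l x) <= M) -> N (g b - g a) <= M * (b - a).
Proof.
move=> ab hg hl; apply: (mean_value_ineq hN) => // x xab e e0.
have [del del0 hd] := hg x xab e e0; exists del => // y yab yx.
have Dy : `[a, b]%classic y by rewrite /= in_itv.
have -> : g y - g x = (g y - g x - (y - x) *: l x) + (y - x) *: l x.
  by rewrite subrK.
apply: le_trans (normD hN _ _) _; rewrite (normZ hN).
have := hd y Dy yx; have := ler_wpM2r (normr_ge0 (y - x)) (hl x xab).
by lra.
Qed.

Definition taylor_sum (w : nat -> R -> 'rV[R]_d) (a : R) (m k : nat) (t : R) :
    'rV[R]_d :=
  \sum_(i < m) ((t - a) ^+ i / i`!%:R) *: w (k + i)%N a.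

(** Each remainder has the next one as its derivative and vanishes at [a], so
    that the mean value inequality gains one power of [t - a]. *)
Lemma taylor_bound (w : nat -> R -> 'rV[R]_d) (a b : R) (L m k : nat) :
  (forall j x, (j < L)%N -> `[a, b]%classic x ->
     deriv_within `[a, b]%classic (w j) x (w j.+1 x)) ->
  {within `[a, b], continuous (w L)} -> (k + m <= L)%N ->
  exists2 M : R, 0 <= M &
    forall t, a <= t <= b -> N (w k t - taylor_sum w a m k t) <= M * (t - a) ^+ m.
Proof.
move=> hw hc; elim: m k => [|m IH] k kL.
  have ck : {within `[a, b], continuous (w k)}.
    move: kL; rewrite addn0 leq_eqVlt => /orP[/eqP->//|kL].
    by apply: (has_deriv_continuous (l := w k.+1)) => x; exact: hw.
  have [M M0 hM] := continuous_bounded_norm hN ck; exists M => // t tab.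
  by rewrite /taylor_sum big_ord0 subr0 expr0 mulr1; exact: hM.
have [|M M0 hM] := IH k.+1; first by rewrite addSnnS.
exists M => // t /andP[at_ tb].
(* The Taylor monomials as polynomials, each one the derivative of the next. *)
pose q (i : nat) : {poly R} := (i`!%:R^-1) *: ('X - a%:P) ^+ i.
have qE i x : (q i).[x] = (x - a) ^+ i / i`!%:R.
  by rewrite /q !hornerE mulrC.
have q0' : (q 0%N)^`() = 0 by rewrite /q expr0 derivZ derivC scaler0.
have qS' i : (q i.+1)^`() = q i.
  rewrite /q derivZ deriv_exp derivXsubC mul1r /= -[_ *+ i.+1]scaler_nat scalerA factS.
  by congr (_ *: _); rewrite natrM invfM mulrAC mulVf ?mul1r// pnatr_eq0.
pose rem (j n : nat) (x : R) := w j x - taylor_sum w a n j x.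
have rem_a : rem k m.+1 a = 0.
  rewrite /rem /taylor_sum big_ord_recl /= expr0 fact0 addn0 divr1 scale1r.
  rewrite big1 => [|i _]; first by rewrite addr0 subrr.
  by rewrite subrr expr0n mul0r scale0r.
have hd x : a <= x <= t ->
    has_deriv N `[a, t]%classic (rem k m.+1) x (rem k.+1 m x).
  move=> /andP[ax xt].
  have sub : `[a, t]%classic `<=` `[a, b]%classic.
    by move=> y /=; rewrite !in_itv /= => /andP[-> yt]; exact: le_trans yt tb.
  have xab : `[a, b]%classic x by rewrite /= in_itv /= ax (le_trans xt tb).
  have h1 : has_deriv N `[a, t]%classic (w k) x (w k.+1 x).
    apply: (has_derivS sub); apply: deriv_within_norm => //; apply: hw => //.
    by apply: leq_trans kL; rewrite -addSnnS leq_addr.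
  have h2 : has_deriv N `[a, t]%classic (taylor_sum w a m.+1 k) x
      (taylor_sum w a m k.+1 x).
    have -> : taylor_sum w a m.+1 k =
        (fun y => \sum_(i < m.+1) (q i).[y] *: w (k + i)%N a).
      by apply/funext => y; apply: eq_bigr => i _; rewrite qE.
    have -> : taylor_sum w a m k.+1 x =
        \sum_(i < m.+1) (q i)^`().[x] *: w (k + i)%N a.
      rewrite big_ord_recl /= q0' horner0 scale0r add0r; apply: eq_bigr => i _.
      by rewrite qS' qE addnS.
    by apply: has_deriv_sum => // i; exact: has_deriv_poly.
  exact: has_derivD h1 (has_derivN hN h2).
have h := mean_value_ineq_deriv at_ hd (M := M * (t - a) ^+ m).
rewrite exprSr mulrA; have := h; rewrite rem_a subr0; apply.
move=> x /andP[ax xt]; apply: le_trans (hM x _) _.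
  by rewrite ax (le_trans xt tb).
by apply: ler_wpM2l => //; apply: lerXn2r; rewrite ?nnegrE; lra.
Qed.

End Taylor.

(** * The phase spaces *)

Section PhaseSpace.
Variables (R : realType) (d : nat).
Implicit Types (phi psi : R -> 'rV[R]_d) (r : \bar R).

Lemma continuous_uniform (a b : R) phi : {within `[a, b], continuous phi} ->
  forall e : R, 0 < e -> exists2 del : R, 0 < del &
    forall x y, a <= x <= b -> a <= y <= b -> `|x - y| < del ->
    `|phi x - phi y| <= e.
Proof.
move=> /continuous_withinP hc e e0; have e2 : 0 < e / 2 by lra.
have [cov _] := compact_near_coveringP `[a, b]%classic.
have {}cov := cov (@segment_compact R a b).
have := cov R (0^'+) (fun del x => a <= x <= b -> forall y, a <= y <= b ->
  `|x - y| < del -> `|phi x - phi y| <= e) _.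
move=> H; have {H} : \forall del \near 0^'+, `[a, b]%classic `<=`
    (fun x => a <= x <= b -> forall y, a <= y <= b ->
  `|x - y| < del -> `|phi x - phi y| <= e).
  apply: H => x xab; have [rho rho0 hr] := hc x xab _ e2.
  have r2 : 0 < rho / 2 by lra.
  exists (ball x (rho / 2), [set del : R | del < rho / 2]).
    by split => /=; [exact: nbhsx_ballx|exact: nbhs_right_lt].
  move=> [x' del] /= [xx' dr] x'ab y yab x'y.
  rewrite /ball /= in xx'.
  have h1 : `|phi x' - phi x| <= e / 2.
    by apply: hr; [rewrite /= in_itv|rewrite distrC; lra].
  have h2 : `|phi y - phi x| <= e / 2.
    apply: hr; first by rewrite /= in_itv.
    have -> : y - x = - (x' - y) - (x - x') by ring.
    by apply: le_lt_trans (ler_normB _ _) _; rewrite normrN; lra.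
  have -> : phi x' - phi y = (phi x' - phi x) - (phi y - phi x).
    by rewrite opprB addrA subrK.
  by apply: le_trans (ler_normB _ _) _; lra.
move=> nd; near (0:R)^'+ => del; exists del => // x y xab yab xy.
have := near nd del; move=> /(_ _ x); apply => //.
Unshelve. all: by end_near.
Qed.

(** An infinite delay needs the limit at -oo: it reduces uniform continuity on
    the half-line to uniform continuity on a segment. *)
Lemma spaceC_uniform r phi : (0 <= r)%E -> spaceC r phi ->
  forall e : R, 0 < e -> exists2 del : R, 0 < del &
    forall x y, hist_itv r x -> hist_itv r y -> `|x - y| < del ->
    `|phi x - phi y| <= e.
Proof.
move=> r0 [hc hl] e e0; case: r r0 hc hl => [r||] r0 hc hl; last by [].
  have hE : hist_itv r%:E = `[- r, 0]%classic.
    by apply/seteqP; split=> x; rewrite /hist_itv /= in_itv /= lee_fin;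
       [case=> -> ->|case/andP].
  rewrite hE in hc; have [del del0 hd] := continuous_uniform hc e0.
  by exists del => // x y; rewrite hE /= !in_itv /=; exact: hd.
have hE : hist_itv (+oo%E : \bar R) = [set x : R | x <= 0].
  by apply/seteqP; split=> x; rewrite /hist_itv /= leNye; [case|].
have e2 : 0 < e / 2 by lra.
have /cvg_ex[l hl'] := hl erefl.
have /cvgrPdist_le hA' := hl'; have [A [_ hA]] := hA' _ e2.
have hc' : {within `[A - 1, 0], continuous phi}.
  apply: continuous_subspaceW hc; rewrite hE => x /=.
  by rewrite in_itv => /andP[].
have [del del0 hd] := continuous_uniform hc' e0.
exists (Order.min 1 del); first by rewrite lt_min ltr01.
have far x y : x < A -> y < A -> `|phi x - phi y| <= e.
  move=> xA yA; have := hA x xA; have := hA y yA => /= h1 h2.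
  have -> : phi x - phi y = (l - phi y) - (l - phi x).
    by apply/rowP => i; rewrite !mxE; ring.
  by apply: le_trans (ler_normB _ _) _; lra.
rewrite hE => x y /= x0 y0; rewrite lt_min => /andP[xy1 xyd].
have := ler_norm (x - y); have := ler_norm (y - x).
rewrite [`|y - x|]distrC => n1 n2.
have [xA|Ax] := ltP x (A - 1); first by apply: far; lra.
have [yA|Ay] := ltP y (A - 1); first by apply: far; lra.
by apply: hd => //; rewrite ?Ax ?Ay.
Qed.

Lemma in_phase_lin X r (a : R) phi psi : in_phase X r phi -> in_phase X r psi ->
  in_phase X r (a *: phi + psi).
Proof.
have hC : spaceC r phi -> spaceC r psi -> spaceC r (a *: phi + psi).
  move=> [c1 l1] [c2 l2]; split.
    move: c1 c2 => /subspace_continuousP c1 /subspace_continuousP c2.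
    apply/subspace_continuousP => x Dx; apply: cvgD; last exact: c2.
    by apply: cvgZl_tmp; exact: c1.
  by move=> rE; apply: is_cvgD; [apply: is_cvgZl_tmp; exact: l1|exact: l2].
case: X => /=; first exact: hC.
move=> [C1 [w [w0 wd wc]]] [C2 [w' [w0' wd' wc']]]; split; first exact: hC.
exists (fun j t => a *: w j t + w' j t); split.
- by rewrite w0 w0'.
- move=> j x jk Dx; have := wd j x jk Dx; have := wd' j x jk Dx.
  rewrite /deriv_within => h1 h2.
  have -> : (fun y => (y - x)^-1 *: (a *: w j y + w' j y - (a *: w j x + w' j x)))
    = (fun y => a *: ((y - x)^-1 *: (w j y - w j x)) +
        (y - x)^-1 *: (w' j y - w' j x)).
    by apply/funext => y; apply/rowP => i; rewrite !mxE; ring.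
  by apply: cvgD => //; exact: cvgZl_tmp.
- move: wc wc' => /subspace_continuousP c1 /subspace_continuousP c2.
  apply/subspace_continuousP => x Dx; apply: cvgD; last exact: c2.
  by apply: cvgZl_tmp; exact: c1.
Qed.

Lemma in_phase0 X r phi : in_phase X r phi -> in_phase X r (0 : R -> 'rV[R]_d).
Proof. by move=> h; have := in_phase_lin (-1) h h; rewrite scaleN1r addNr. Qed.

Lemma in_phaseZ X r (a : R) phi : in_phase X r phi -> in_phase X r (a *: phi).
Proof.
by move=> h; have := in_phase_lin a h (in_phase0 h); rewrite addr0.
Qed.

Lemma in_phaseD X r phi psi : in_phase X r phi -> in_phase X r psi ->
  in_phase X r (phi + psi).
Proof. by move=> h h'; have := in_phase_lin 1 h h'; rewrite scale1r. Qed.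

Lemma in_phaseB X r phi psi : in_phase X r phi -> in_phase X r psi ->
  in_phase X r (phi - psi).
Proof. by move=> h h'; have := in_phase_lin (-1) h' h; rewrite scaleN1r addrC. Qed.

End PhaseSpace.

(** * The maximum norm and the right-hand side *)

Section HistoryNorm.
Variables (R : realType) (X : phase_space) (P : rfde R).
Hypothesis hN : is_norm (vnorm P).
Hypothesis r0 : (0 <= delay P)%E.
Implicit Types chi psi : R -> 'rV[R]_(rdim P).
Implicit Types T : (R -> 'rV[R]_(rdim P)) -> 'rV[R]_(rdim P).

Lemma hist_itv0 : hist_itv (delay P) 0.
Proof. by split=> //; rewrite leeNl oppe0. Qed.

Lemma hnorm_le chi (B : R) :
  (forall th, hist_itv (delay P) th -> vnorm P (chi th) <= B) -> hnorm chi <= B.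
Proof.
move=> h; apply: ge_sup; first by exists (vnorm P (chi 0)), 0; first exact: hist_itv0.
by move=> _ [th hth <-]; exact: h.
Qed.

Lemma hnorm_ge0 chi : 0 <= hnorm chi.
Proof.
rewrite /hnorm; set S := [set _ | _ in _].
have [hS|hS] := pselect (has_sup S); last by rewrite sup_out.
apply: le_trans (norm_ge0 hN (chi 0)) _; apply: ub_le_sup; first by case: hS.
by exists 0 => //; exact: hist_itv0.
Qed.

Lemma phase_linear0 T : phase_linear X T ->
  in_phase X (delay P) (0 : R -> 'rV[R]_(rdim P)) ->
  T 0 = 0.
Proof.
move=> hT h0; have := hT 1 0 0 h0 h0; rewrite !scale1r addr0 => h.
by apply: (addrI (T 0)); rewrite -h addr0.
Qed.

Lemma phase_linearZ T a chi : phase_linear X T -> in_phase X (delay P) chi ->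
  T (a *: chi) = a *: T chi.
Proof.
move=> hT h; have h0 := in_phase0 h.
by have := hT a chi 0 h h0; rewrite addr0 (phase_linear0 hT h0) addr0.
Qed.

Lemma phase_linear_sum T (I : Type) (s : seq I) (Q : pred I) (a : I -> R)
    (chi : I -> R -> 'rV[R]_(rdim P)) :
  phase_linear X T -> in_phase X (delay P) (0 : R -> 'rV[R]_(rdim P)) ->
  (forall i, in_phase X (delay P) (chi i)) ->
  in_phase X (delay P) (\sum_(i <- s | Q i) a i *: chi i) /\
  T (\sum_(i <- s | Q i) a i *: chi i) = \sum_(i <- s | Q i) a i *: T (chi i).
Proof.
move=> hT h0 h; elim: s => [|i s [IH1 IH2]].
  by rewrite !big_nil; split=> //; exact: phase_linear0.
rewrite !big_cons; case: (Q i) => //; split; first exact: in_phase_lin.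
by rewrite hT// IH2.
Qed.

(** The mean value inequality applied twice, to the derivative in the direction
    [chi] and then to the right-hand side.  The increment enters through a
    pointwise bound [B], which the error analysis of the stages provides
    directly. *)
Lemma rhs_taylor
    (Df : R -> (R -> 'rV[R]_(rdim P)) -> (R -> 'rV[R]_(rdim P)) ->
      'rV[R]_(rdim P))
    D2f (M t B : R) psi chi :
  is_deriv1 X Df -> is_deriv2 X Df D2f ->
  (forall t psi, rdom P (t, psi) -> forall chi1 chi2,
    in_phase X (delay P) chi1 -> in_phase X (delay P) chi2 ->
    vnorm P (D2f t psi chi1 chi2) <= M * hnorm chi1 * hnorm chi2) ->
  0 <= M -> in_phase X (delay P) chi ->
  (forall th, hist_itv (delay P) th -> vnorm P (chi th) <= B) ->
  (forall l : R, 0 <= l <= 1 -> rdom P (t, psi + l *: chi)) ->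
  vnorm P (rhs P t (psi + chi) - rhs P t psi - Df t psi chi) <= M * B ^+ 2.
Proof.
move=> h1 h2 hM M0 hchi hB hdom.
have B0 : 0 <= B := le_trans (norm_ge0 hN (chi 0)) (hB 0 hist_itv0).
have hnZ (a : R) : hnorm (a *: chi) <= `|a| * B.
  apply: hnorm_le => th hth; rewrite fctE (normZ hN).
  by apply: ler_wpM2l => //; exact: hB.
have shift (l m : R) : psi + m *: chi = psi + l *: chi + (m - l) *: chi.
  by rewrite -addrA -scalerDl; congr (_ + _ *: _); ring.
have small (del y x : R) : 0 < del -> `|y - x| < del / (B + 1) ->
    `|y - x| * B < del.
  move=> del0; have B1 : 0 < B + 1 by lra.
  rewrite ltr_pdivlMr// => h; apply: le_lt_trans h.
  by apply: ler_wpM2l => //; lra.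
have dom0 : rdom P (t, psi) by have := hdom 0; rewrite scale0r addr0; apply; lra.
have [lin0 _] := h1 t psi dom0.
(* The derivative in the direction chi varies by at most M B^2. *)
have step1 (l : R) : 0 <= l <= 1 ->
    vnorm P (Df t (psi + l *: chi) chi - Df t psi chi) <= M * B ^+ 2.
  move=> /andP[l0 l1].
  have := @mean_value_ineq _ _ _ hN (fun x => Df t (psi + x *: chi) chi) 0 l
    (M * B ^+ 2) l0.
  rewrite scale0r addr0 subr0 => H; apply: (@le_trans _ _ (M * B ^+ 2 * l)).
    apply: H => x /andP[x0 xl] e e0.
    have domx : rdom P (t, psi + x *: chi) by apply: hdom; lra.
    have [_ _ hd] := h2 _ _ domx.
    have e1 : 0 < e / (B ^+ 2 + 1) by rewrite divr_gt0// ltr_wpDl// sqr_ge0.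
    have [del del0 {}hd] := hd _ e1.
    exists (del / (B + 1)); first by rewrite divr_gt0//; lra.
    move=> y /andP[y0 yl] yx.
    have domy : rdom P (t, psi + y *: chi) by apply: hdom; lra.
    have hc : in_phase X (delay P) ((y - x) *: chi) by exact: in_phaseZ.
    have hny := hnZ (y - x).
    have := hd _ hc (le_lt_trans hny (small _ _ _ del0 yx)).
    rewrite -shift => /(_ domy chi hchi) hdd; have hMM := hM _ _ domx _ _ hc hchi.
    have bound k : 0 <= k -> k * hnorm ((y - x) *: chi) * hnorm chi <=
        k * B ^+ 2 * `|y - x|.
      move=> k0; have -> : k * B ^+ 2 * `|y - x| = k * (`|y - x| * B * B) by ring.
      rewrite -mulrA; apply: ler_wpM2l => //.
      by apply: ler_pM => //; rewrite ?hnorm_ge0// hnorm_le.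
    rewrite -[X in vnorm P X](subrK (D2f t (psi + x *: chi) ((y - x) *: chi) chi)).
    apply: le_trans (normD hN _ _) _; rewrite addrC mulrDl; apply: lerD.
      exact: le_trans hMM (bound _ M0).
    apply: le_trans hdd _; apply: le_trans (bound _ (ltW e1)) _.
    apply: ler_wpM2r => //; rewrite mulrAC ler_pdivrMr ?ltr_wpDl ?sqr_ge0//.
    by apply: ler_wpM2l; lra.
  by apply: ler_piMr => //; rewrite mulr_ge0// sqr_ge0.
have := @mean_value_ineq _ _ _ hN
  (fun x => rhs P t (psi + x *: chi) - x *: Df t psi chi) 0 1 (M * B ^+ 2) ler01.
rewrite scale0r addr0 scale0r !scale1r subr0 subr0 mulr1 addrAC; apply.
move=> x x01 e e0; have domx := hdom x x01.
have [linx hd] := h1 _ _ domx.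
have e1 : 0 < e / (B + 1) by rewrite divr_gt0//; lra.
have [del del0 {}hd] := hd _ e1.
exists (del / (B + 1)); first by rewrite divr_gt0//; lra.
move=> y y01 yx; have domy := hdom y y01.
have hc : in_phase X (delay P) ((y - x) *: chi) by exact: in_phaseZ.
have hny := hnZ (y - x).
have := hd _ hc (le_lt_trans hny (small _ _ _ del0 yx)).
rewrite -shift => /(_ domy); rewrite (phase_linearZ _ linx hchi) => hdd.
set f1 := rhs P t (psi + y *: chi) in hdd *.
set f0 := rhs P t (psi + x *: chi) in hdd *.
have -> : f1 - y *: Df t psi chi - (f0 - x *: Df t psi chi) =
    (y - x) *: (Df t (psi + x *: chi) chi - Df t psi chi) +
    (f1 - f0 - (y - x) *: Df t (psi + x *: chi) chi).
  by apply/rowP => j; rewrite !mxE; ring.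
apply: le_trans (normD hN _ _) _; rewrite mulrDl; apply: lerD.
  by rewrite (normZ hN) mulrC; apply: ler_wpM2r => //; exact: step1.
apply: le_trans hdd _; apply: (@le_trans _ _ (e / (B + 1) * (`|y - x| * B))).
  by apply: ler_wpM2l => //; exact: ltW.
have -> : e / (B + 1) * (`|y - x| * B) = e * B / (B + 1) * `|y - x| by ring.
apply: ler_wpM2r => //; rewrite ler_pdivrMr; last by lra.
by apply: ler_wpM2l; lra.
Qed.

End HistoryNorm.

(** * The solution near the initial time *)

Lemma avoid_finite (R : realType) (B : seq R) (a b : R) : a < b ->
  exists2 y, a < y <= b & forall z, z \in B -> ~ (a < z < y).
Proof.
move=> ab; elim: B => [|z B [y /andP[ay yb] hy]].
  by exists b; rewrite ?ab ?lexx.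
have [za|az] := leP z a.
  exists y; first by rewrite ay.
  by move=> z'; rewrite inE => /orP[/eqP->|/hy//]; lra.
exists (Order.min y z); first by rewrite lt_min ay az /= ge_min yb.
move=> z'; rewrite inE lt_min => /orP[/eqP->|/hy h]; first by rewrite ltxx !andbF.
by move=> /and3P[h1 h2 _]; apply: h; rewrite h1.
Qed.

Section NearInitialTime.
Variables (R : realType) (X : phase_space) (P : rfde R).
Hypothesis hN : is_norm (vnorm P).
Hypothesis r0 : (0 <= delay P)%E.
Variables (sigma : R) (phi : R -> 'rV[R]_(rdim P)) (v0 : 'rV[R]_(rdim P)).
Variables (tbar : \bar R) (u v : R -> 'rV[R]_(rdim P)).
Hypothesis hsol : is_solution sigma phi v0 tbar u v.

(** Up to the first breakpoint after the initial time, the solution has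
    successive derivatives [w k]; the differential equation identifies the
    first two. *)
Lemma smooth_start (L : nat) :
  (2 <= L)%N -> piecewiseC L (full_itv P sigma tbar) u ->
  exists2 D : R, 0 < D & exists w : nat -> R -> 'rV[R]_(rdim P),
  [/\ forall j x, (j < L)%N -> `[sigma, sigma + D]%classic x ->
        deriv_within `[sigma, sigma + D]%classic (w j) x (w j.+1 x),
      {within `[sigma, sigma + D], continuous (w L)},
      forall t, sigma <= t <= sigma + D -> sol_itv sigma tbar t,
      w 0%N = u &
      forall t, sigma <= t <= sigma + D ->
        w 1%N t = v t /\ w 2%N t = rhs P t (segment u t)].
Proof.
move=> L2 pu; case: hsol => st _ _ hs.
have [b sb bt] : exists2 b : R, sigma < b & (b%:E < tbar)%E.
  case: tbar st => [T||//]; last by exists (sigma + 1); [lra|exact: ltry].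
  by rewrite lte_fin => st; exists ((sigma + T) / 2); rewrite ?lte_fin; lra.
have sub : `[sigma, b]%classic `<=` full_itv P sigma tbar.
  move=> t /=; rewrite in_itv /= => /andP[t1 t2]; split.
    apply: (@le_trans _ _ sigma%:E); last by rewrite lee_fin.
    case: (delay P) r0 => [r||] //=; last by rewrite leNye.
    by rewrite -EFinB !lee_fin gerBl.
  by apply: le_lt_trans bt; rewrite lee_fin.
have [B hB] := pu _ _ sub; have [y /andP[sy yb] hy] := avoid_finite B sb.
have [w [w0 wd wc]] := hB sigma y (lexx _) sy yb hy.
have yE : sigma + (y - sigma) = y by rewrite addrC subrK.
exists (y - sigma); first by rewrite subr_gt0.
exists w; rewrite yE.
have sol t : sigma <= t <= y -> sol_itv sigma tbar t.
  move=> /andP[t1 t2]; split=> //.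
  by apply: le_lt_trans bt; rewrite lee_fin (le_trans t2 yb).
have ssub : `[sigma, y]%classic `<=` sol_itv sigma tbar.
  by move=> t /=; rewrite in_itv /=; exact: sol.
have e1 t : sigma <= t <= y -> w 1%N t = v t.
  move=> ht; have Dt : `[sigma, y]%classic t by rewrite /= in_itv.
  have /(deriv_within_norm hN) h1 := wd 0%N t (ltnW L2) Dt.
  have [_ /(deriv_within_norm hN)/(has_derivS ssub) h2 _] := hs t (sol t ht).
  by rewrite w0 in h1; exact: (has_deriv_uniq hN sy ht h1 h2).
split=> // t ht; split; first exact: e1.
have Dt : `[sigma, y]%classic t by rewrite /= in_itv.
have /(deriv_within_norm hN) h1 := wd 1%N t L2 Dt.
have [_ _ /(deriv_within_norm hN)/(has_derivS ssub) h2] := hs t (sol t ht).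
by apply: (has_deriv_uniq hN sy ht) h2; apply: has_deriv_ext h1.
Qed.

Hypothesis hphi : rdom P (sigma, phi).
Hypothesis hopen : dom_open X P.

(** Continuity at the initial time of the segments of the solution, in the
    maximum norm: uniform continuity of the history serves the part of a
    segment before the initial time, right continuity of the solution the part
    after it. *)
Lemma segment_close (e : R) : 0 < e ->
  exists2 del : R, 0 < del & forall t th, 0 <= t < del ->
  hist_itv (delay P) th -> vnorm P (u (sigma + t + th) - phi th) <= e.
Proof.
move=> e0; case: hsol => st hu _ hs.
have sphi : spaceC (delay P) phi.
  by have [+ _] := hopen hphi; case: X => //= -[].
have [C C0 hC] := norm_le_mxnorm hN.
have e2 : 0 < e / (2 * C) by rewrite divr_gt0// mulr_gt0.
have [d1 d10 hd1] := spaceC_uniform r0 sphi e2.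
have modulus x y : hist_itv (delay P) x -> hist_itv (delay P) y ->
    `|x - y| < d1 -> vnorm P (phi x - phi y) <= e / 2.
  move=> hx hy xy; apply: le_trans (hC _) _.
  have -> : e / 2 = C * (e / (2 * C)) by field; rewrite gt_eqF.
  by rewrite ler_pM2l// hd1.
have hs0 : sol_itv sigma tbar sigma by split.
have [_ /(deriv_within_norm hN) hd _] := hs _ hs0.
have [d2 d20 hd2] := hd 1 ltr01.
have V0 : 0 < 1 + vnorm P (v sigma) by have := norm_ge0 hN (v sigma); lra.
have [d3 d30 hd3] : exists2 d3 : R, 0 < d3 &
    forall t, 0 <= t < d3 -> sol_itv sigma tbar (sigma + t).
  case: tbar st => [T||//].
    rewrite lte_fin => st; exists (T - sigma); first by rewrite subr_gt0.
    by move=> t ht; split; rewrite ?lte_fin; lra.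
  by move=> _; exists 1 => // t ht; split; rewrite ?ltry//; lra.
have right t : 0 <= t -> t < d2 -> t < d3 ->
    t < e / 2 / (1 + vnorm P (v sigma)) -> vnorm P (u (sigma + t) - phi 0) <= e / 2.
  move=> t0 td2 td3; rewrite ltr_pdivlMr// => te.
  have tE : sigma + t - sigma = t by rewrite addrAC subrr add0r.
  rewrite -hu; last exact: hist_itv0.
  rewrite addr0; have := hd2 (sigma + t) (hd3 _ _); rewrite tE ger0_norm// t0.
  move=> /(_ td3 td2) h.
  have -> : u (sigma + t) - u sigma =
    (u (sigma + t) - u sigma - t *: v sigma) + t *: v sigma by rewrite subrK.
  by apply: le_trans (normD hN _ _) _; rewrite (normZ hN) ger0_norm//; lra.
exists (Order.min (Order.min d1 d2) (Order.min d3 (e / 2 / (1 + vnorm P (v sigma))))).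
  by rewrite !lt_min d10 d20 d30 !divr_gt0.
move=> t th; rewrite !lt_min => /andP[t0 /andP[/andP[td1 td2] /andP[td3 te]]] hth.
have [h1 h2] := hth.
have [neg|pos] := leP (t + th) 0.
  have hth' : hist_itv (delay P) (t + th).
    by split=> //; apply: le_trans h1 _; rewrite lee_fin; lra.
  rewrite -addrA hu//; apply: le_trans (modulus _ _ hth' hth _) _; last by lra.
  by rewrite addrK ger0_norm.
have -> : u (sigma + t + th) - phi th =
    (u (sigma + (t + th)) - phi 0) + (phi 0 - phi th).
  by rewrite addrA subrK addrA.
apply: le_trans (normD hN _ _) _.
have a1 : vnorm P (u (sigma + (t + th)) - phi 0) <= e / 2 by apply: right; lra.
have a2 : vnorm P (phi 0 - phi th) <= e / 2.
  by apply: modulus => //; [exact: hist_itv0|rewrite sub0r normrN ler0_norm//; lra].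
by lra.
Qed.

(** The openness of the domain at the initial data alone gives a neighbourhood
    of uniform radius of all the segments of the solution at small times. *)
Lemma uniform_tube : exists2 e : R, 0 < e & forall t chi, 0 <= t < e ->
  sol_itv sigma tbar (sigma + t) -> in_phase X (delay P) chi ->
  (forall th, hist_itv (delay P) th -> vnorm P (chi th) <= e) ->
  rdom P (sigma + t, segment u (sigma + t) + chi).
Proof.
have [_ [rho rho0 hrho]] := hopen hphi.
have r4 : 0 < rho / 4 by lra.
have [del del0 hdel] := segment_close r4.
exists (Order.min del (rho / 4)); first by rewrite lt_min del0.
move=> t chi; rewrite lt_min => /andP[t0 /andP[td tr]] ht hchi hB.
case: hsol => _ _ _ hs; have [dom _ _] := hs _ ht.
have [pu _] := hopen dom.
apply: hrho; first exact: in_phaseD.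
  by rewrite addrAC subrr add0r ger0_norm//; lra.
apply: (@le_lt_trans _ _ (rho / 2)); last by lra.
apply: (hnorm_le r0) => th hth.
have -> : (segment u (sigma + t) + chi - phi) th =
    (u (sigma + t + th) - phi th) + chi th.
  by rewrite !fctE /segment addrAC.
apply: le_trans (normD hN _ _) _.
have h1 : vnorm P (u (sigma + t + th) - phi th) <= rho / 4.
  by apply: hdel => //; rewrite t0.
have := hB th hth; have : Order.min del (rho / 4) <= rho / 4.
  by rewrite ge_min lexx orbT.
by lra.
Qed.

End NearInitialTime.

(** * Errors of the stages and sufficiency of the conditions *)

Section StageErrors.
Variables (R : realType) (X : phase_space) (P : rfde R).
Hypothesis hN : is_norm (vnorm P).
Hypothesis r0 : (0 <= delay P)%E.
Variables (sigma : R) (phi : R -> 'rV[R]_(rdim P)) (v0 : 'rV[R]_(rdim P)).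
Variables (tbar : \bar R) (u v : R -> 'rV[R]_(rdim P)).
Hypothesis hsol : is_solution sigma phi v0 tbar u v.
Hypothesis hphi : rdom P (sigma, phi).
Hypothesis hopen : dom_open X P.

Variables (s : nat) (A : 'M[{poly R}]_s) (c : 'I_s -> R).
Hypothesis A_lower : forall i j : 'I_s, (i <= j)%N -> A i j = 0.
Hypothesis c_ge0 : forall i, 0 <= c i.
Hypothesis hA : forall (i : 'I_s) (alpha : R), 0 <= alpha <= c i ->
  \sum_(j < s) (A i j).[alpha] = alpha ^+ 2 / 2.

Variables (D : R) (w : nat -> R -> 'rV[R]_(rdim P)) (L : nat).
Hypothesis D0 : 0 < D.
Hypothesis L6 : (6 <= L)%N.
Hypothesis w_deriv : forall j x, (j < L)%N -> `[sigma, sigma + D]%classic x ->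
  deriv_within `[sigma, sigma + D]%classic (w j) x (w j.+1 x).
Hypothesis w_cont : {within `[sigma, sigma + D], continuous (w L)}.
Hypothesis w_sol : forall t, sigma <= t <= sigma + D -> sol_itv sigma tbar t.
Hypothesis w0u : w 0%N = u.
Hypothesis w12 : forall t, sigma <= t <= sigma + D ->
  w 1%N t = v t /\ w 2%N t = rhs P t (segment u t).

Let stage h K i x := stage A phi v0 h K i x.
Let stages h K := @is_stages _ s A c P sigma phi v0 h K.
Let tau h (i : 'I_s) := sigma + c i * h.
Let dev h (K : 'I_s -> 'rV[R]_(rdim P)) i := K i - w 2%N (tau h i).
(** The leading coefficient of the error of a stage function. *)
Let G (i : 'I_s) (x : R) := \sum_(j < s) (A i j).[x] * c j - x ^+ 3 / 6.

Let cmax := 1 + \sum_i c i.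

Lemma cmax_ge i : c i <= cmax.
Proof.
rewrite /cmax (bigD1 i)//= addrCA lerDl addr_ge0// sumr_ge0//.
Qed.

Lemma cmax_ge1 : 1 <= cmax.
Proof. by rewrite lerDl sumr_ge0. Qed.

Lemma time_in_range h i : 0 < h -> h <= D / cmax ->
  sigma <= tau h i <= sigma + D.
Proof.
have c1 := cmax_ge1; rewrite ler_pdivlMr => [h0 hD|]; last by lra.
rewrite lerDl mulr_ge0 ?(ltW h0)// lerD2l; apply: le_trans hD.
by rewrite mulrC ler_wpM2l ?cmax_ge// ltW.
Qed.

Lemma taylor_sum4 t : taylor_sum w sigma 4 0 t = w 0%N sigma +
  (t - sigma) *: w 1%N sigma + ((t - sigma) ^+ 2 / 2) *: w 2%N sigma +
  ((t - sigma) ^+ 3 / 6) *: w 3%N sigma.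
Proof.
rewrite /taylor_sum !big_ord_recr big_ord0 /= add0r expr0 expr1 fact0 !divr1.
by rewrite scale1r.
Qed.

Lemma taylor_sum2 k t : taylor_sum w sigma 2 k t =
  w k sigma + (t - sigma) *: w k.+1 sigma.
Proof.
rewrite /taylor_sum !big_ord_recr big_ord0 /= add0r expr0 expr1 !divr1.
by rewrite scale1r addn0 addn1.
Qed.

Lemma initial_values : w 0%N sigma = phi 0 /\ w 1%N sigma = v0.
Proof.
case: hsol => _ hu hv _; split; first by rewrite w0u -hu ?addr0//; exact: hist_itv0.
by rewrite -hv; apply: (w12 _).1; rewrite lexx lerDl ltW.
Qed.

(** The stage values are [w 2 + (c j * h) *: w 3] at the initial time, up to the
    deviations of the preceding stages and a remainder of order [h ^+ 2].  By
    the condition on the sums of the [A i j] the terms in [w 2] agree with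
    those of the Taylor expansion of the solution, and the terms in [w 3] leave
    [G i]. *)
Lemma stage_error_expansion : exists2 M : R, 0 <= M &
  forall h K i x, 0 < h -> h <= 1 -> h <= D / cmax -> 0 < x -> x <= c i * h ->
  vnorm P (stage h K i x - u (sigma + x) - (h ^+ 3 * G i (x / h)) *: w 3%N sigma)
   <= M * (h ^+ 2 * \sum_(j < s | (j < i)%N) vnorm P (dev h K j) + h ^+ 4).
Proof.
have c1 := cmax_ge1; have c0 : 0 <= cmax by lra.
have [Ma Ma0 hMa] := poly_family_bounded (fun ij : 'I_s * 'I_s => A ij.1 ij.2) c0.
have [|M0 M00 hM0] := taylor_bound (k := 0%N) (m := 4%N) hN w_deriv w_cont.
  exact: leq_trans L6.
have [|M2 M20 hM2] := taylor_bound (k := 2%N) (m := 2%N) hN w_deriv w_cont.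
  exact: leq_trans L6.
exists (Ma + s%:R * (Ma * (M2 * cmax ^+ 2)) + M0 * cmax ^+ 4).
  by rewrite !addr_ge0 ?mulr_ge0 ?exprn_ge0.
move=> h K i x h0 h1 hD x0 xc; have [i1 i2] := initial_values.
have hn0 : h != 0 by rewrite gt_eqF.
set q := x / h.
have xE : x = q * h by rewrite /q divfK.
have q0 : 0 <= q by rewrite divr_ge0 ?ltW.
have qc : q <= c i by rewrite /q ler_pdivrMr.
have qcm : `|q| <= cmax by rewrite ger0_norm// (le_trans qc (cmax_ge i)).
pose a j := (A i j).[q].
have ha j : `|a j| <= Ma by exact: (hMa (i, j)).
have restrict (V : nmodType) (F : 'I_s -> V) :
    (forall j : 'I_s, (i <= j)%N -> F j = 0) ->
    \sum_j F j = \sum_(j < s | (j < i)%N) F j.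
  move=> hF; rewrite [RHS]big_mkcond; apply: eq_bigr => j _.
  by case: ltnP => // ij; rewrite hF.
have suma : \sum_(j < s | (j < i)%N) a j = q ^+ 2 / 2.
  rewrite -restrict ?hA ?q0// => j ij; by rewrite /a A_lower// horner0.
have GE : G i q = \sum_(j < s | (j < i)%N) a j * c j - q ^+ 3 / 6.
  by rewrite /G -restrict// => j ij; rewrite /a A_lower// horner0 mul0r.
pose T j := w 2%N sigma + (c j * h) *: w 3%N sigma.
have E : stage h K i x - u (sigma + x) - (h ^+ 3 * G i q) *: w 3%N sigma =
  h ^+ 2 *: (\sum_(j < s | (j < i)%N) a j *: dev h K j) +
  h ^+ 2 *: (\sum_(j < s | (j < i)%N) a j *: (w 2%N (tau h j) - T j)) -
  (w 0%N (sigma + x) - taylor_sum w sigma 4 0 (sigma + x)).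
  rewrite taylor_sum4 i1 i2 w0u /stage /Defs.stage leNgt x0 /= -/q.
  have -> : \sum_(j < s | (j < i)%N) (A i j).[q] *: K j =
    \sum_(j < s | (j < i)%N) a j *: dev h K j +
    \sum_(j < s | (j < i)%N) a j *: (w 2%N (tau h j) - T j) +
    (q ^+ 2 / 2) *: w 2%N sigma +
    (h * \sum_(j < s | (j < i)%N) a j * c j) *: w 3%N sigma.
    rewrite -suma mulr_sumr !scaler_suml -!big_split; apply: eq_bigr => j _ /=.
    by rewrite /a /dev /T; apply/rowP => k; rewrite !mxE; ring.
  have -> : sigma + x - sigma = x by rewrite addrAC subrr add0r.
  rewrite GE xE; set S1 := \sum_(_ < s | _) _ *: _.
  set S2 := \sum_(_ < s | _) _ *: _; set S3 := \sum_(_ < s | _) _ * _.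
  by apply/rowP => k; rewrite !mxE; field.
have tauE j : tau h j - sigma = c j * h by rewrite /tau addrAC subrr add0r.
have b1 : vnorm P (\sum_(j < s | (j < i)%N) a j *: dev h K j) <=
    Ma * \sum_(j < s | (j < i)%N) vnorm P (dev h K j).
  apply: le_trans (norm_sum hN _ _ _) _; rewrite mulr_sumr.
  by apply: ler_sum => j _; rewrite (normZ_le hN).
have b2 : vnorm P (\sum_(j < s | (j < i)%N) a j *: (w 2%N (tau h j) - T j)) <=
    s%:R * (Ma * (M2 * cmax ^+ 2)) * h ^+ 2.
  apply: le_trans (norm_sum hN _ _ _) _.
  apply: (@le_trans _ _ (\sum_(j < s) Ma * (M2 * cmax ^+ 2) * h ^+ 2)).
    rewrite [leLHS]big_mkcond; apply: ler_sum => j _.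
    have pos : 0 <= Ma * (M2 * cmax ^+ 2) * h ^+ 2.
      by rewrite !mulr_ge0 ?exprn_ge0// ltW.
    case: ifP => // _; rewrite -mulrA; apply: normZ_le => //.
    have := hM2 (tau h j) (time_in_range j h0 hD).
    rewrite taylor_sum2 tauE => /le_trans; apply; rewrite -mulrA -exprMn.
    apply: ler_wpM2l => //; apply: lerXn2r; rewrite ?nnegrE ?mulr_ge0 ?(ltW h0) ?(ltW x0)//.
    by rewrite ler_pM2r// cmax_ge.
  by rewrite sumr_const card_ord -[_ *+ s]mulr_natl mulrA.
have b3 : vnorm P (w 0%N (sigma + x) - taylor_sum w sigma 4 0 (sigma + x)) <=
    M0 * cmax ^+ 4 * h ^+ 4.
  have /hM0 : sigma <= sigma + x <= sigma + D.
    have := time_in_range i h0 hD; rewrite /tau => /andP[_]; rewrite !lerD2l => cD.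
    by rewrite lerDl ltW//= (le_trans xc cD).
  move=> /le_trans; apply; rewrite addrAC subrr add0r -mulrA -exprMn.
  apply: ler_wpM2l => //; apply: lerXn2r; rewrite ?nnegrE ?mulr_ge0 ?(ltW h0) ?(ltW x0)//.
  by apply: le_trans xc _; rewrite ler_pM2r// cmax_ge.
have h20 : 0 <= h ^+ 2 by rewrite exprn_ge0// ltW.
have S0 : 0 <= \sum_(j < s | (j < i)%N) vnorm P (dev h K j).
  by rewrite sumr_ge0// => j _; exact: norm_ge0.
rewrite E; apply: le_trans (normB hN _ _) _.
apply: le_trans (lerD (normD hN _ _) b3) _.
rewrite !(normZ hN) ger0_norm//.
apply: le_trans (lerD (lerD (ler_wpM2l h20 b1) (ler_wpM2l h20 b2)) (lexx _)) _.
move: S0; set S := \sum_(_ < s | _) _ => S0.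
set Z := s%:R * (Ma * (M2 * cmax ^+ 2)); set W := M0 * cmax ^+ 4.
have Z0 : 0 <= Z by rewrite !mulr_ge0 ?exprn_ge0.
have W0 : 0 <= W by rewrite mulr_ge0 ?exprn_ge0.
have -> : (Ma + Z + W) * (h ^+ 2 * S + h ^+ 4) =
  h ^+ 2 * (Ma * S) + h ^+ 2 * (Z * h ^+ 2) + W * h ^+ 4 +
  ((Z + W) * (h ^+ 2 * S) + Ma * h ^+ 4) by ring.
rewrite lerDl; apply: addr_ge0; apply: mulr_ge0;
  by rewrite ?addr_ge0 ?mulr_ge0 ?exprn_ge0 ?(ltW h0).
Qed.

Variables (Df : R -> (R -> 'rV[R]_(rdim P)) -> (R -> 'rV[R]_(rdim P)) ->
  'rV[R]_(rdim P)).
Variables (D2f : R -> (R -> 'rV[R]_(rdim P)) -> (R -> 'rV[R]_(rdim P)) ->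
  (R -> 'rV[R]_(rdim P)) -> 'rV[R]_(rdim P)).
Hypothesis hDf : is_deriv1 X Df.
Hypothesis hDfb : bounded1 X Df.
Hypothesis hD2f : is_deriv2 X Df D2f.
Hypothesis hD2fb : bounded2 X D2f.

Let lag h K i : R -> 'rV[R]_(rdim P) :=
  segment (stage h K i) (c i * h) - segment u (tau h i).

Lemma lagE h K i th :
  lag h K i th = stage h K i (c i * h + th) - u (sigma + (c i * h + th)).
Proof. by rewrite /lag !fctE /segment /tau addrA. Qed.

Lemma lag_past h K i th : 0 < h -> hist_itv (delay P) th -> c i * h + th <= 0 ->
  lag h K i th = 0.
Proof.
move=> h0 [th1 th2] neg; rewrite lagE /stage /Defs.stage neg.
case: hsol => _ hu _ _; rewrite hu ?subrr//; split=> //.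
apply: le_trans th1 _; rewrite lee_fin lerDr mulr_ge0//; exact: ltW.
Qed.

(** Induction over the stages.  The deviations of the preceding stages enter
    with a factor [h ^+ 2], so that for small [h] the bound obtained for a
    stage does not depend on theirs and one constant serves all the stages. *)
Lemma stage_values : exists2 C : R, 0 <= C & exists2 h0 : R,
  [/\ 0 < h0, h0 <= 1 & h0 <= D / cmax] &
  forall h K, 0 < h -> h <= h0 -> stages h K -> forall i,
  [/\ vnorm P (dev h K i) <= C * h ^+ 3,
      vnorm P (dev h K i - Df (tau h i) (segment u (tau h i)) (lag h K i))
        <= C * h ^+ 4,
      in_phase X (delay P) (lag h K i) &
      forall x, 0 < x -> x <= c i * h ->
      vnorm P (stage h K i x - u (sigma + x) - (h ^+ 3 * G i (x / h)) *: w 3%N sigma)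
       <= C * h ^+ 4].
Proof.
have c1 := cmax_ge1; have c0 : 0 <= cmax by lra.
have cp : 0 < cmax by lra.
have [e e0 tube] := uniform_tube hN r0 hsol hphi hopen.
have [M M0 hM] := stage_error_expansion.
have [MG MG0 hMG] : exists2 MG : R, 0 <= MG & forall i x, `|x| <= cmax -> `|G i x| <= MG.
  have [MG MG0 hMG] := poly_family_bounded
    (fun i : 'I_s => \sum_j A i j * (c j)%:P - (6^-1) *: 'X^3) c0.
  exists MG => // i x hx; have := hMG i x hx; rewrite /G hornerD hornerN hornerZ hornerXn horner_sum.
  rewrite [6^-1 * _]mulrC; congr (`|_ - _| <= _); apply: eq_bigr => j _.
  by rewrite hornerM hornerC.
have [M1 M10 hM1] : exists2 M1 : R, 0 <= M1 & forall t psi, rdom P (t, psi) ->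
    forall chi, in_phase X (delay P) chi -> vnorm P (Df t psi chi) <= M1 * hnorm chi.
  have [M1 hM1] := hDfb; exists `|M1| => // t psi d chi hchi.
  apply: le_trans (hM1 _ _ d _ hchi) _; apply: ler_wpM2r; last exact: ler_norm.
  exact: hnorm_ge0.
have [M2 M20 hM2] : exists2 M2 : R, 0 <= M2 & forall t psi, rdom P (t, psi) ->
    forall chi1 chi2, in_phase X (delay P) chi1 -> in_phase X (delay P) chi2 ->
    vnorm P (D2f t psi chi1 chi2) <= M2 * hnorm chi1 * hnorm chi2.
  have [M2 hM2] := hD2fb; exists `|M2| => // t psi d chi1 chi2 hc1 hc2.
  apply: le_trans (hM2 _ _ d _ _ hc1 hc2) _; apply: ler_wpM2r; first exact: hnorm_ge0.
  by apply: ler_wpM2r; [exact: hnorm_ge0|exact: ler_norm].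
pose B0 := 2 * M + MG * vnorm P (w 3%N sigma).
have B00 : 0 <= B0 by rewrite addr_ge0// mulr_ge0// norm_ge0.
pose C := M1 * B0 + M2 * B0 ^+ 2 + 2 * M.
have C0 : 0 <= C by rewrite !addr_ge0 ?mulr_ge0 ?exprn_ge0.
have C1 : 0 < s%:R * C + 1 by rewrite ltr_wpDl// mulr_ge0.
exists C => //.
(* The step size is limited by the interval of smoothness, by the radius e of
   the tube, in time and in the history, and by s C h <= 1, which absorbs the
   preceding stages. *)
exists (Order.min (Order.min 1 (D / cmax)) (Order.min (e / (2 * cmax))
  (Order.min (e / (B0 + 1)) (s%:R * C + 1)^-1))).
  split; last 2 first.
  - by rewrite !ge_min lexx.
  - by rewrite !ge_min lexx !orbT.
  - rewrite !lt_min ltr01 !divr_gt0 ?invr_gt0 ?mulr_gt0//.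
    by rewrite ltr_wpDl.
move=> h K h0; rewrite !le_min => /andP[/andP[h1 hD] /andP[he /andP[hB hC]]] hst.
move: he hB hC; rewrite ler_pdivlMr ?mulr_gt0// => he.
rewrite ler_pdivlMr ?ltr_wpDl// => hB; rewrite -[_^-1]mul1r ler_pdivlMr// => hC.
have hp n : 0 <= h ^+ n by rewrite exprn_ge0// ltW.
have hle m n : (m <= n)%N -> h ^+ n <= h ^+ m.
  by move=> mn; apply: ler_wiXn2l => //; exact: ltW.
suff H n (i : 'I_s) : i = n :> nat -> 
  [/\ vnorm P (dev h K i) <= C * h ^+ 3,
      vnorm P (dev h K i - Df (tau h i) (segment u (tau h i)) (lag h K i))
        <= C * h ^+ 4,
      in_phase X (delay P) (lag h K i) &
      forall x, 0 < x -> x <= c i * h ->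
      vnorm P (stage h K i x - u (sigma + x) - (h ^+ 3 * G i (x / h)) *: w 3%N sigma)
       <= C * h ^+ 4].
  by move=> i; exact: (H i i).
elim/ltn_ind: n i => n IH i iE.
have prev : \sum_(j < s | (j < i)%N) vnorm P (dev h K j) <= s%:R * C * h ^+ 3.
  apply: (@le_trans _ _ (\sum_(j < s) C * h ^+ 3)).
    rewrite [leLHS]big_mkcond; apply: ler_sum => j _.
    case: ifP => [ji|_]; last by rewrite mulr_ge0 ?hp.
    by have [] := IH j _ j erefl; rewrite -?iE.
  by rewrite sumr_const card_ord -[_ *+ s]mulr_natl mulrA.
have e4 x : 0 < x -> x <= c i * h ->
    vnorm P (stage h K i x - u (sigma + x) - (h ^+ 3 * G i (x / h)) *: w 3%N sigma)
       <= 2 * M * h ^+ 4.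
  move=> x0 xc; apply: le_trans (hM _ _ _ _ h0 h1 hD x0 xc) _.
  have -> : 2 * M * h ^+ 4 = M * (h ^+ 4 + h ^+ 4) by ring.
  apply: ler_wpM2l => //; rewrite lerD2r.
  apply: le_trans (ler_wpM2l (hp 2%N) prev) _.
  have -> : h ^+ 2 * (s%:R * C * h ^+ 3) = (s%:R * C * h) * h ^+ 4 by ring.
  by rewrite ler_piMl ?hp//; lra.
have e3 x : 0 < x -> x <= c i * h ->
    vnorm P (stage h K i x - u (sigma + x)) <= B0 * h ^+ 3.
  move=> x0 xc; rewrite -[X in vnorm P X](subrK ((h ^+ 3 * G i (x / h)) *: w 3%N sigma)).
  apply: le_trans (normD hN _ _) _; rewrite /B0 mulrDl; apply: lerD.
    apply: le_trans (e4 _ x0 xc) _; apply: ler_wpM2l; last exact: hle.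
    by rewrite mulr_ge0 ?hp.
  rewrite (normZ hN) normrM [`|h ^+ 3|]ger0_norm; last exact: hp.
  rewrite [h ^+ 3 * _]mulrC mulrAC.
  apply: ler_wpM2r; first exact: hp.
  apply: ler_wpM2r; first exact: norm_ge0.
  apply: hMG; rewrite ger0_norm; last by rewrite divr_ge0 ?(ltW h0) ?(ltW x0).
  rewrite ler_pdivrMr//; apply: le_trans xc _.
  by apply: ler_wpM2r (cmax_ge i); exact: ltW.
have lag_le th : hist_itv (delay P) th -> vnorm P (lag h K i th) <= B0 * h ^+ 3.
  move=> hth; have [neg|pos] := leP (c i * h + th) 0.
    by rewrite lag_past// norm0// mulr_ge0 ?hp.
  by rewrite lagE; apply: e3 => //; case: hth => _; lra.
have [d1 Ki] := hst i; rewrite -/(tau h i) in d1 Ki.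
have range := time_in_range i h0 hD.
have stau := w_sol range.
have [d2 _ _] : _ := (let: And4 _ _ _ hs := hsol in hs _ stau).
have [ph1 _] := hopen d1; have [ph2 _] := hopen d2.
have phl : in_phase X (delay P) (lag h K i) by exact: in_phaseB.
have segE : segment u (tau h i) + lag h K i = segment (stage h K i) (c i * h).
  by rewrite /lag addrC subrK.
have B0h : B0 * h ^+ 3 <= e.
  apply: (@le_trans _ _ (B0 * h)); last by lra.
  by apply: ler_wpM2l => //; have := hle 1%N 3%N isT; rewrite expr1.
have tl (l : R) : 0 <= l <= 1 -> rdom P (tau h i, segment u (tau h i) + l *: lag h K i).
  move=> /andP[l0 l1]; apply: tube => //; last first.
  - move=> th hth; rewrite !fctE (normZ hN) ger0_norm//.
    apply: le_trans B0h; apply: le_trans (lag_le th hth).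
    by rewrite ler_piMl// norm_ge0.
  - exact: in_phaseZ.
  - rewrite mulr_ge0 ?(ltW h0)//=; have := ler_wpM2r (ltW h0) (cmax_ge i).
    by have := mulr_gt0 h0 cp; lra.
have devE : dev h K i = rhs P (tau h i) (segment u (tau h i) + lag h K i) -
    rhs P (tau h i) (segment u (tau h i)).
  by rewrite segE -(w12 range).2 /dev Ki.
have quad := rhs_taylor hN r0 hDf hD2f hM2 M20 phl lag_le tl.
rewrite -devE in quad.
have quad' k : (k <= 6)%N ->
    vnorm P (dev h K i - Df (tau h i) (segment u (tau h i)) (lag h K i)) <=
    M2 * B0 ^+ 2 * h ^+ k.
  move=> k6; apply: le_trans quad _; rewrite -mulrA; apply: ler_wpM2l => //.
  by rewrite exprMn -exprM; apply: ler_wpM2l; [rewrite exprn_ge0|exact: hle].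
split=> //.
- rewrite -[X in vnorm P X](subrK (Df (tau h i) (segment u (tau h i)) (lag h K i))).
  apply: le_trans (normD hN _ _) _; apply: le_trans (lerD (quad' 3%N isT) (hM1 _ _ d2 _ phl)) _.
  have := ler_wpM2l M10 (hnorm_le r0 lag_le).
  have : 0 <= 2 * M * h ^+ 3 by apply: mulr_ge0; [exact: mulr_ge0|exact: hp].
  by rewrite /C; lra.
- apply: le_trans (quad' 4%N isT) _; apply: ler_wpM2r; first exact: hp.
  by rewrite /C; have := mulr_ge0 M10 B00; lra.
- move=> x x0 xc; apply: le_trans (e4 _ x0 xc) _; apply: ler_wpM2r; first exact: hp.
  rewrite /C; have := mulr_ge0 M10 B00; have : 0 <= M2 * B0 ^+ 2.
    by rewrite mulr_ge0// exprn_ge0.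
  by lra.
Qed.

(** A stage chosen for each abscissa, which splits sums over the stages by
    abscissa. *)
Let rep i := odflt i [pick j | c j == c i].

Lemma repP i : c (rep i) = c i.
Proof. by rewrite /rep; case: pickP => //= j /eqP. Qed.

Lemma rep_eq i j : c i = c j -> rep i = rep j.
Proof.
move=> cij; rewrite /rep (eq_pick (Q := fun k => c k == c j)); last first.
  by move=> k; rewrite cij.
by case: pickP => //= /(_ j); rewrite eqxx.
Qed.

(** Stages with the same abscissa see the right-hand side linearised at the
    same point.  By linearity their errors combine before the linearisation is
    applied, and only the combination has to be small. *)
Lemma weighted_defect (Mb : R) : 0 <= Mb ->
  exists2 C : R, 0 <= C & exists2 h0 : R, [/\ 0 < h0, h0 <= 1 & h0 <= D / cmax] &
  forall h K, 0 < h -> h <= h0 -> stages h K ->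
  (forall i, vnorm P (dev h K i) <= C * h ^+ 3) /\
  forall bw : 'I_s -> R, (forall i, `|bw i| <= Mb) ->
  (forall i0 x, 0 <= x <= c i0 ->
    \sum_(i < s | c i == c i0) bw i * G i x = 0) ->
  vnorm P (\sum_i bw i *: dev h K i) <= C * h ^+ 4.
Proof.
move=> Mb0; have [C C0 [h0 h0p hC]] := stage_values.
have [M1 hM1] := hDfb.
pose C' := s%:R * (s%:R * (Mb * C) + `|M1| * (s%:R * (Mb * C))).
have sC0 : 0 <= s%:R * (Mb * C) by rewrite !mulr_ge0.
have C'0 : 0 <= C' by rewrite mulr_ge0// addr_ge0// mulr_ge0.
exists (C + C'); first exact: addr_ge0.
exists h0 => // h K hp hh0 hst; have {}hC := hC h K hp hh0 hst.
have hn n : 0 <= h ^+ n by rewrite exprn_ge0// ltW.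
split=> [i|bw hbw hG].
  have [hi _ _ _] := hC i; apply: le_trans hi _; apply: ler_wpM2r; first exact: hn.
  by rewrite lerDl.
have [h01 h02 hD] := h0p.
have sumle (V : 'I_s -> 'rV[R]_(rdim P)) (Q : pred 'I_s) :
    (forall i, Q i -> vnorm P (V i) <= C * h ^+ 4) ->
    vnorm P (\sum_(i | Q i) bw i *: V i) <= s%:R * (Mb * C) * h ^+ 4.
  move=> hV; apply: le_trans (norm_sum hN _ _ _) _.
  apply: (@le_trans _ _ (\sum_(i < s) Mb * C * h ^+ 4)).
    rewrite [leLHS]big_mkcond; apply: ler_sum => i _.
    have pos : 0 <= Mb * C * h ^+ 4 by apply: mulr_ge0; [exact: mulr_ge0|exact: hn].
    case: ifP => // Qi; rewrite -mulrA; apply: normZ_le => //; exact: hV.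
  by rewrite sumr_const card_ord -[_ *+ s]mulr_natl mulrA.
have group j : vnorm P (\sum_(i | c i == c j) bw i *: dev h K i) <=
    (s%:R * (Mb * C) + `|M1| * (s%:R * (Mb * C))) * h ^+ 4.
  pose T := Df (tau h j) (segment u (tau h j)).
  have range := time_in_range j hp (le_trans hh0 hD).
  have [dom _ _] : _ := (let: And4 _ _ _ hs := hsol in hs _ (w_sol range)).
  have [Tlin _] := hDf dom.
  have ph i : in_phase X (delay P) (lag h K i) by have [] := hC i.
  have ph0 := in_phase0 (ph j).
  have [phs Ts] := phase_linear_sum (index_enum 'I_s) (fun i => c i == c j) bw
    Tlin ph0 ph.
  have -> : \sum_(i | c i == c j) bw i *: dev h K i =
      \sum_(i | c i == c j) bw i *: (dev h K i - T (lag h K i)) +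
      T (\sum_(i | c i == c j) bw i *: lag h K i).
    rewrite [X in _ + X]Ts -big_split; apply: eq_bigr => i _ /=.
    by rewrite -scalerDr subrK.
  apply: le_trans (normD hN _ _) _; rewrite mulrDl; apply: lerD.
    apply: sumle => i /eqP cij; have [_ + _ _] := hC i.
    by rewrite /T /tau cij.
  apply: le_trans (hM1 _ _ dom _ phs) _; rewrite -mulrA.
  apply: (@le_trans _ _ (`|M1| * hnorm (\sum_(i | c i == c j) bw i *: lag h K i))).
    by apply: ler_wpM2r; [exact: hnorm_ge0|exact: ler_norm].
  apply: ler_wpM2l => //; apply: (hnorm_le r0) => th hth.
  have -> : (\sum_(i | c i == c j) bw i *: lag h K i) th =
      \sum_(i | c i == c j) bw i *: lag h K i th.
    by rewrite fct_sumE.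
  have [neg|pos] := leP (c j * h + th) 0.
    rewrite big1 => [|i /eqP cij]; first by rewrite norm0//; apply: mulr_ge0 (hn _).
    by rewrite lag_past ?scaler0// cij.
  set x := c j * h + th in pos; pose e i := stage h K i x - u (sigma + x) -
    (h ^+ 3 * G i (x / h)) *: w 3%N sigma.
  have xc : x <= c j * h by rewrite /x gerDl; case: hth.
  have zero : \sum_(i | c i == c j) bw i * G i (x / h) = 0.
    by apply: hG; rewrite divr_ge0 ?(ltW pos) ?(ltW hp)//= ler_pdivrMr.
  have -> : \sum_(i | c i == c j) bw i *: lag h K i th =
      \sum_(i | c i == c j) bw i *: e i.
    transitivity (\sum_(i | c i == c j) bw i *: e i +
        (h ^+ 3 * \sum_(i | c i == c j) bw i * G i (x / h)) *: w 3%N sigma).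
      rewrite mulr_sumr scaler_suml -big_split; apply: eq_bigr => i /eqP cij /=.
      rewrite lagE cij -/x /e; apply/rowP => k; rewrite !mxE; ring.
    by rewrite zero mulr0 scale0r addr0.
  apply: sumle => i /eqP cij; have [_ _ _] := hC i; apply=> //.
  by rewrite cij.
rewrite (partition_big rep xpredT)//=.
apply: le_trans (norm_sum hN _ _ _) _.
apply: (@le_trans _ _ (C' * h ^+ 4)); last first.
  by apply: ler_wpM2r; [exact: hn|rewrite lerDr].
move: group; rewrite /C'; set Z := _ + `|M1| * _ => group.
have -> : s%:R * Z * h ^+ 4 = \sum_(j < s) Z * h ^+ 4.
  by rewrite sumr_const card_ord -[Z * _ *+ s]mulr_natl; ring.
apply: ler_sum => j _; have [rj|rj] := eqVneq (rep j) j.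
  rewrite (eq_bigl (fun i => c i == c j)); first exact: group.
  move=> i /=; apply/eqP/eqP => [<-|/rep_eq ->]; last exact: rj.
  by rewrite repP.
rewrite big_pred0 => [|i].
  by rewrite norm0//; apply: mulr_ge0 (hn _); rewrite addr_ge0// mulr_ge0.
apply/eqP => rij; case/eqP: rj; rewrite -[RHS]rij; apply: rep_eq.
by rewrite -rij repP.
Qed.

Lemma taylor_quadrature (g : 'I_s -> R) (m : nat) (S : nat -> R) h :
  (forall k : 'I_m, \sum_i g i * c i ^+ k = S k) ->
  \sum_i g i *: taylor_sum w sigma m 2 (tau h i) =
  \sum_(k < m) (h ^+ k / k`!%:R * S k) *: w (2 + k)%N sigma.
Proof.
move=> hS; under eq_bigr do rewrite scaler_sumr.
rewrite exchange_big; apply: eq_bigr => k _ /=.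
rewrite -hS mulr_sumr scaler_suml; apply: eq_bigr => i _.
rewrite scalerA /tau addrAC subrr add0r exprMn; congr (_ *: _); ring.
Qed.

Lemma quadrature_remainder (g : 'I_s -> R) (Mb M : R) (m : nat) h :
  0 <= Mb -> 0 <= M -> 0 < h -> h <= D / cmax -> (forall i, `|g i| <= Mb) ->
  (forall t, sigma <= t <= sigma + D ->
    vnorm P (w 2%N t - taylor_sum w sigma m 2 t) <= M * (t - sigma) ^+ m) ->
  vnorm P (\sum_i g i *: (w 2%N (tau h i) - taylor_sum w sigma m 2 (tau h i)))
    <= s%:R * (Mb * (M * cmax ^+ m)) * h ^+ m.
Proof.
move=> Mb0 M0 h0 hD hg hM; have c0 : 0 <= cmax by have := cmax_ge1; lra.
apply: le_trans (norm_sum hN _ _ _) _.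
apply: (@le_trans _ _ (\sum_(i < s) Mb * (M * cmax ^+ m) * h ^+ m)); last first.
  by rewrite sumr_const card_ord -[_ *+ s]mulr_natl !mulrA.
apply: ler_sum => i _; rewrite -mulrA; apply: normZ_le => //.
apply: le_trans (hM _ (time_in_range i h0 hD)) _.
rewrite /tau addrAC subrr add0r -mulrA -exprMn; apply: ler_wpM2l => //.
apply: lerXn2r; rewrite ?nnegrE ?mulr_ge0 ?(ltW h0)//.
by rewrite ler_pM2r// cmax_ge.
Qed.

Variables (b b' : 'I_s -> {poly R}).
Hypothesis b'_moment : forall (k : 'I_4) (alpha : R), 0 <= alpha <= 1 ->
  \sum_i (b' i).[alpha] * c i ^+ k = alpha ^+ k.+1 / k.+1%:R.
Hypothesis b_moment : forall (k : 'I_3) (alpha : R), 0 <= alpha <= 1 ->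
  \sum_i (b i).[alpha] * c i ^+ k = alpha ^+ k.+2 / (k.+1 * k.+2)%:R.
Hypothesis b'_stage : forall (alpha : R), 0 <= alpha <= 1 ->
  forall i0 x, 0 <= x <= c i0 ->
  \sum_(i < s | c i == c i0) (b' i).[alpha] * G i x = 0.

(** The moments make the Taylor polynomials of the numerical and of the exact
    solution cancel ([taylor_quadrature]).  Of the deviations of the stage
    values only those weighted by [b'] have to combine well: those weighted by
    [b] carry a factor [h ^+ 2], for which their size [h ^+ 3] is enough. *)
Lemma order_four_bound :
  (exists2 h1 : R, 0 < h1 & forall h, 0 < h -> h <= h1 -> exists K, stages h K) ->
  local_error_bound A b b' c sigma phi v0 u v 4.
Proof.
move=> [h1 h10 hex]; have c1 := cmax_ge1.
have [Mb Mb0 hMb] := poly_family_bounded b ler01.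
have [Mb' Mb'0 hMb'] := poly_family_bounded b' ler01.
have [C C0 [h0 [h00 h01 h0D] hC]] := weighted_defect Mb'0.
have [|M1 M10 hM1] := taylor_bound (k := 1%N) (m := 5%N) hN w_deriv w_cont.
  exact: L6.
have [|M0 M00 hM0] := taylor_bound (k := 0%N) (m := 5%N) hN w_deriv w_cont.
  exact: leq_trans L6.
have [|M2 M20 hM2] := taylor_bound (k := 2%N) (m := 4%N) hN w_deriv w_cont.
  exact: L6.
have [|M3 M30 hM3] := taylor_bound (k := 2%N) (m := 3%N) hN w_deriv w_cont.
  exact: leq_trans L6.
pose Q m Mg M := s%:R * (Mg * (M * cmax ^+ m)).
have Q0 m Mg M : 0 <= Mg -> 0 <= M -> 0 <= Q m Mg M.
  by move=> g0 M_0; rewrite /Q !mulr_ge0// exprn_ge0//; lra.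
exists (Order.min h0 h1), (1 + (s%:R * (Mb * C) + Q 3%N Mb M3 + M0)),
  (1 + (C + Q 4%N Mb' M2 + M1)).
have P0 : 0 <= s%:R * (Mb * C) by rewrite !mulr_ge0.
have q3 := Q0 3%N _ _ Mb0 M30; have q4 := Q0 4%N _ _ Mb'0 M20.
split; [by rewrite lt_min h00|by lra|by lra|].
move=> h hp; rewrite le_min => /andP[hh0 hh1].
have [K hst] := hex h hp hh1; exists K => // alpha alpha01.
have [a0 a1] : 0 <= alpha /\ alpha <= 1 by lra.
have hD := le_trans hh0 h0D.
have [dev3 wdev] := hC h K hp hh0 hst.
have hn n : 0 <= h ^+ n by rewrite exprn_ge0// ltW.
have absa : `|alpha| <= 1 by rewrite ger0_norm.
have [i1 i2] := initial_values.
have ah : alpha * h <= h by rewrite ler_piMl// ltW.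
have ah0 : 0 <= alpha * h by rewrite mulr_ge0// ltW.
have range : sigma <= sigma + alpha * h <= sigma + D.
  rewrite lerDl ah0 lerD2l (le_trans ah)// (le_trans hD)// ler_pdivrMr; last by lra.
  by apply: ler_peMr => //; exact: ltW.
have ahE : sigma + alpha * h - sigma = alpha * h by rewrite addrAC subrr add0r.
have pow5 M : 0 <= M -> M * (sigma + alpha * h - sigma) ^+ 5 <= M * h ^+ 5.
  move=> M_0; rewrite ahE; apply: ler_wpM2l => //.
  by apply: lerXn2r; rewrite ?nnegrE// ltW.
split.
- have -> : Defs.eta b phi v0 h K alpha - u (sigma + alpha * h) =
      h ^+ 2 *: (\sum_i (b i).[alpha] *: dev h K i) +
      h ^+ 2 *: (\sum_i (b i).[alpha] *:
        (w 2%N (tau h i) - taylor_sum w sigma 3 2 (tau h i))) -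
      (w 0%N (sigma + alpha * h) - taylor_sum w sigma 5 0 (sigma + alpha * h)).
    have -> : taylor_sum w sigma 5 0 (sigma + alpha * h) = phi 0 +
        (alpha * h) *: v0 +
        h ^+ 2 *: (\sum_i (b i).[alpha] *: taylor_sum w sigma 3 2 (tau h i)).
      rewrite (taylor_quadrature (S := fun k => alpha ^+ k.+2 / (k.+1 * k.+2)%:R));
        last by move=> k; exact: b_moment.
      rewrite /taylor_sum ahE !big_ord_recr !big_ord0 /= !addSn !add0n i1 i2.
      have [-> -> ->] : [/\ 2`! = 2, 3`! = 6 & 4`! = 24]%N by [].
      by rewrite fact0 !natrM; apply/rowP => k; rewrite !mxE; field.
    rewrite w0u /Defs.eta.
    have -> : \sum_i (b i).[alpha] *: K i = \sum_i (b i).[alpha] *: dev h K i +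
       \sum_i (b i).[alpha] *: (w 2%N (tau h i) - taylor_sum w sigma 3 2 (tau h i)) +
       \sum_i (b i).[alpha] *: taylor_sum w sigma 3 2 (tau h i).
      rewrite -!big_split; apply: eq_bigr => i _ /=.
      by rewrite /dev -!scalerDr; congr (_ *: _); rewrite -addrA subrK subrK.
    set S1 := \sum_i _; set S2 := \sum_i _; set S3 := \sum_i _.
    by apply/rowP => k; rewrite !mxE; ring.
  apply: le_trans (normB hN _ _) _.
  apply: le_trans (lerD (normD hN _ _) (le_trans (hM0 _ range) (pow5 _ M00))) _.
  have d1 : vnorm P (\sum_i (b i).[alpha] *: dev h K i) <= s%:R * (Mb * C) * h ^+ 3.
    apply: le_trans (norm_sum hN _ _ _) _.
    apply: (@le_trans _ _ (\sum_(i < s) Mb * C * h ^+ 3)); last first.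
      by rewrite sumr_const card_ord -[_ *+ s]mulr_natl !mulrA.
    by apply: ler_sum => i _; rewrite -mulrA; apply: normZ_le => //; exact: hMb.
  have d2 := quadrature_remainder Mb0 M30 hp hD (fun i => hMb i alpha absa) hM3.
  rewrite !(normZ hN) ger0_norm ?hn// -/(Q 3%N Mb M3) in d2 *.
  have h5 : h ^+ 5 = h ^+ 2 * h ^+ 3 by ring.
  have := ler_wpM2l (hn 2%N) d1; have := ler_wpM2l (hn 2%N) d2; have := hn 5%N.
  by rewrite h5; lra.
- have -> : Defs.eta' b' v0 h K alpha - v (sigma + alpha * h) =
      h *: (\sum_i (b' i).[alpha] *: dev h K i) +
      h *: (\sum_i (b' i).[alpha] *:
        (w 2%N (tau h i) - taylor_sum w sigma 4 2 (tau h i))) -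
      (w 1%N (sigma + alpha * h) - taylor_sum w sigma 5 1 (sigma + alpha * h)).
    have -> : taylor_sum w sigma 5 1 (sigma + alpha * h) = v0 +
        h *: (\sum_i (b' i).[alpha] *: taylor_sum w sigma 4 2 (tau h i)).
      rewrite (taylor_quadrature (S := fun k => alpha ^+ k.+1 / k.+1%:R));
        last by move=> k; exact: b'_moment.
      rewrite /taylor_sum ahE !big_ord_recr !big_ord0 /= !addSn !add0n i2.
      have [-> -> -> ->] : [/\ 1`! = 1, 2`! = 2, 3`! = 6 & 4`! = 24]%N by [].
      by rewrite fact0; apply/rowP => k; rewrite !mxE; field.
    rewrite (w12 range).1 /Defs.eta'.
    have -> : \sum_i (b' i).[alpha] *: K i = \sum_i (b' i).[alpha] *: dev h K i +
       \sum_i (b' i).[alpha] *: (w 2%N (tau h i) - taylor_sum w sigma 4 2 (tau h i)) +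
       \sum_i (b' i).[alpha] *: taylor_sum w sigma 4 2 (tau h i).
      rewrite -!big_split; apply: eq_bigr => i _ /=.
      by rewrite /dev -!scalerDr; congr (_ *: _); rewrite -addrA subrK subrK.
    set S1 := \sum_i _; set S2 := \sum_i _; set S3 := \sum_i _.
    by apply/rowP => k; rewrite !mxE; ring.
  apply: le_trans (normB hN _ _) _.
  apply: le_trans (lerD (normD hN _ _) (le_trans (hM1 _ range) (pow5 _ M10))) _.
  have d1 := wdev _ (fun i => hMb' i alpha absa) (b'_stage alpha01).
  have d2 := quadrature_remainder Mb'0 M20 hp hD (fun i => hMb' i alpha absa) hM2.
  rewrite !(normZ hN) [`|h|]ger0_norm ?(ltW hp)// -/(Q 4%N Mb' M2) in d2 *.
  have h5 : h ^+ 5 = h * h ^+ 4 by ring.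
  have := ler_wpM2l (ltW hp) d1; have := ler_wpM2l (ltW hp) d2; have := hn 5%N.
  by rewrite h5; lra.
Qed.

End StageErrors.

(** * Test problems *)

Section TestProblem.
Variables (R : realType) (X : phase_space).
Implicit Types (p : {poly R}) (chi psi : R -> 'rV[R]_1).

Definition poly_curve p (x : R) : 'rV[R]_1 := const_mx p.[x].

Definition abs_row (x : 'rV[R]_1) : R := `|x 0 0|.

Lemma abs_row_norm : is_norm abs_row.
Proof.
split=> [x|a x|x y]; rewrite /abs_row.
- move=> /eqP; rewrite normr_eq0 => /eqP x0.
  by apply/rowP => j; rewrite ord1 x0 mxE.
- by rewrite mxE normrM.
- by rewrite mxE ler_normD.
Qed.

Lemma abs_row_le (x : 'rV[R]_1) : abs_row x <= `|x|.
Proof.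
rewrite [`|x|]mx_normrE.
exact: (@le_bigmax _ _ _ _ (fun ij : 'I_1 * 'I_1 => `|x ij.1 ij.2|) (0, 0)).
Qed.

Lemma poly_curve_deriv p D x : deriv_within D (poly_curve p) x (poly_curve p^`() x).
Proof.
apply/deriv_withinP.
have E q : poly_curve q = fun t => q.[t] *: const_mx 1.
  by apply/funext => t; apply/rowP => j; rewrite !mxE mulr1.
by rewrite !E; exact: (has_deriv_poly (@is_norm_mxnorm R 1)).
Qed.

Lemma poly_curve_classC k p D : classC k D (poly_curve p).
Proof.
exists (fun j => poly_curve p^`(j)); split.
- by rewrite derivn0.
- by move=> j x _ _; rewrite derivnS; exact: poly_curve_deriv.
- by apply: (has_deriv_continuous (l := poly_curve p^`(k)^`())) => x _;
    exact: poly_curve_deriv.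
Qed.

Lemma poly_curve_phase p : in_phase X 1%:E (poly_curve p).
Proof.
have C : spaceC 1%:E (poly_curve p).
  by split=> //; have [w [w0 _ +]] := poly_curve_classC 0 p (hist_itv 1%:E);
    rewrite w0.
by case: X => //; split=> //; exact: poly_curve_classC.
Qed.

Lemma segment_poly_curve p t : exists q, (fun x => poly_curve p (t + x)) = poly_curve q.
Proof.
exists (p \Po (t%:P + 'X)); apply/funext => x.
by rewrite /poly_curve horner_comp !hornerE.
Qed.

Lemma hist_itv1 : hist_itv (1%:E : \bar R) = `[-1, 0]%classic.
Proof.
by apply/seteqP; split=> x; rewrite /hist_itv /= in_itv /= lee_fin;
  [case=> -> ->|case/andP].
Qed.

Lemma phase_continuous psi : in_phase X 1%:E psi ->
  {within `[-1, 0], continuous psi}.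
Proof.
by rewrite -hist_itv1; case: X => /= -[]//; case.
Qed.

(** Keeps the delay of the test problems within the history interval. *)
Definition clamp (t : R) : R := Order.max 0 (Order.min t 1).

Lemma clamp_itv t : 0 <= clamp t <= 1.
Proof. by rewrite /clamp le_max lexx /= ge_max ler01 ge_min lexx orbT. Qed.

Lemma clamp_le0 t : t <= 0 -> clamp t = 0.
Proof. by move=> t0; rewrite /clamp max_l// ge_min t0. Qed.

Lemma clamp_id t : 0 <= t -> t <= 1 -> clamp t = t.
Proof. by move=> t0 t1; rewrite /clamp min_l// max_r. Qed.

Lemma clamp_lip x y : `|clamp x - clamp y| <= `|x - y|.
Proof.
have cases z : z <= 0 /\ clamp z = 0 \/
    (0 <= z /\ z <= 1) /\ clamp z = z \/ 1 <= z /\ clamp z = 1.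
  have [z0|z0] := leP z 0; first by left; rewrite clamp_le0.
  have [z1|z1] := leP z 1; right; [left|right].
    by rewrite clamp_id// ltW.
  by rewrite /clamp min_r ?ltW// max_r// ltW.
have := ler_norm (x - y); have := ler_norm (y - x).
rewrite [`|y - x|]distrC ler_norml => n1 n2; apply/andP.
by case: (cases x) => [[? ->]|[[? ->]|[? ->]]];
  case: (cases y) => [[? ->]|[[? ->]|[? ->]]]; split; lra.
Qed.

Variables (gate : R -> R) (q : R).
Hypothesis gate_le1 : forall t, `|gate t| <= 1.
Hypothesis gate_cont : forall t, 0 < t -> {for t, continuous gate}.
Hypothesis q01 : 0 <= q <= 1.

(** The gate may oscillate without limit as t decreases to 0, because the
    difference that it multiplies tends to 0. *)
Definition gated (t : R) chi : R :=
  gate t * (chi (- ((1 - q) * clamp t)) 0 0 - chi (- clamp t) 0 0).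

Lemma gated_lin t (a : R) chi psi :
  gated t (a *: chi + psi) = a * gated t chi + gated t psi.
Proof.
have E x : (a *: chi + psi) x 0 0 = a * chi x 0 0 + psi x 0 0.
  by rewrite -[(_ + _) x]/(a *: chi x + psi x) !mxE.
by rewrite /gated !E; ring.
Qed.

Lemma gated0 t : gated t 0 = 0.
Proof.
by have := gated_lin t (-1) 0 0; rewrite scaler0 addr0 mulN1r addNr.
Qed.

Lemma gate_times_continuous (D : R -> R) :
  (forall t, t <= 0 -> D t = 0) -> continuous D ->
  continuous (fun t : R => gate t * D t).
Proof.
move=> D0 cD t; have [t0|tp] := leP t 0; last first.
  by apply: cvgM; [exact: gate_cont|exact: cD].
apply/cvgrPdist_le => e e0.
have /cvgrPdist_le/(_ e e0) := cD t; apply: filterS => y /=.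
rewrite D0// !mulr0 !sub0r !normrN normrM => h.
by apply: le_trans h; rewrite ler_piMl.
Qed.

Lemma clamp_continuous : continuous clamp.
Proof.
move=> t; apply/cvgrPdist_le => e e0; apply/nbhs_ballP; exists e => //= y.
by rewrite /ball /= => h; apply: le_trans (clamp_lip _ _) (ltW h).
Qed.

Lemma history_at_continuous psi k : 0 <= k <= 1 -> in_phase X 1%:E psi ->
  continuous (fun t : R => psi (- (k * clamp t)) 0 0).
Proof.
move=> /andP[k0 k1] /phase_continuous/continuous_withinP hc t.
have itv y : `[-1, 0]%classic (- (k * clamp y)).
  have /andP[y0 y1] := clamp_itv y; rewrite /= in_itv /= lerN2 oppr_le0.
  by rewrite mulr_ge0// andbT mulr_ile1.
apply/cvgrPdist_le => e e0; have [del del0 hd] := hc _ (itv t) e e0.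
apply/nbhs_ballP; exists del => //= y; rewrite /ball /= => h.
apply: le_trans (hd _ (itv y) _); last first.
  rewrite -opprD normrN -mulrBr normrM ger0_norm//.
  apply: le_lt_trans h; rewrite -[leRHS]mul1r; apply: ler_pM => //.
  by rewrite distrC clamp_lip.
by rewrite distrC; have := abs_row_le (psi (- (k * clamp y)) - psi (- (k * clamp t)));
  rewrite /abs_row !mxE.
Qed.

Lemma gated_continuous psi : in_phase X 1%:E psi ->
  continuous (fun t : R => gated t psi).
Proof.
have /andP[q0 q1] := q01.
move=> hpsi; apply: (gate_times_continuous (D := fun t => _ - _)).
  by move=> t t0; rewrite clamp_le0// mulr0 subrr.
move=> t; apply: cvgB; first by apply: history_at_continuous => //; lra.
have := @history_at_continuous psi 1; under eq_fun do rewrite mul1r.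
by apply=> //; lra.
Qed.

Variable k : nat.

(** The solution to be, with second derivative t^k. *)
Definition test_poly : {poly R} := (k.+1 * k.+2)%:R^-1 *: 'X^(k.+2).

Lemma test_poly_deriv : test_poly^`() = k.+1%:R^-1 *: 'X^(k.+1).
Proof.
rewrite /test_poly derivZ derivXn -['X^_ *+ _]scaler_nat scalerA natrM invfM; congr (_ *: _).
by rewrite mulfVK// pnatr_eq0.
Qed.

Lemma test_poly_deriv2 : test_poly^`()^`() = 'X^k.
Proof.
rewrite test_poly_deriv derivZ derivXn -['X^_ *+ _]scaler_nat scalerA mulVf ?scale1r//.
Qed.

Let ups (t : R) : R -> 'rV[R]_1 := fun x => poly_curve test_poly (t + x).

(** The gated feedback acts on the deviation from the chosen solution, which
    therefore solves the equation whatever the gate. *)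
Definition test_rhs (t : R) psi : 'rV[R]_1 :=
  const_mx (t ^+ k + gated t (psi - ups t)).

Definition test_problem : rfde R :=
  @Rfde R 1 abs_row 1%:E [set z | in_phase X 1%:E z.2] test_rhs.

Lemma ups_phase t : in_phase X 1%:E (ups t).
Proof.
have [p hp] := segment_poly_curve test_poly t.
have -> : ups t = poly_curve p by rewrite -hp.
exact: poly_curve_phase.
Qed.

Lemma test_delay_ge0 : (0 <= delay test_problem)%E.
Proof. by rewrite lee_fin. Qed.

(** Histories are bounded on [-1, 0], so that the supremum in [hnorm] bounds
    every value; this makes the feedback a bounded functional. *)
Lemma value_le_hnorm chi th : in_phase X 1%:E chi -> -1 <= th <= 0 ->
  `|chi th 0 0| <= hnorm (P := test_problem) chi.
Proof.
move=> hchi hth.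
have [M M0 hM] := continuous_bounded (phase_continuous hchi).
apply: ub_le_sup; last first.
  by exists th => //=; rewrite hist_itv1 /= in_itv.
exists M => _ [x hx <-]; apply: le_trans (abs_row_le _) _; apply: hM.
by move: hx; rewrite /= hist_itv1 /= in_itv.
Qed.

Lemma gated_bounded t chi : in_phase X 1%:E chi ->
  `|gated t chi| <= 2 * hnorm (P := test_problem) chi.
Proof.
move=> hchi; rewrite /gated normrM; have /andP[q0 q1] := q01.
have /andP[t0 t1] := clamp_itv t.
have h1 : `|chi (- clamp t) 0 0| <= hnorm (P := test_problem) chi.
  by apply: value_le_hnorm => //; lra.
have h2 : `|chi (- ((1 - q) * clamp t)) 0 0| <= hnorm (P := test_problem) chi.
  apply: value_le_hnorm => //; rewrite lerN2 oppr_le0.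
  by rewrite mulr_ge0 ?mulr_ile1//; lra.
have := ler_normB (chi (- ((1 - q) * clamp t)) 0 0) (chi (- clamp t) 0 0).
move=> h3; apply: (@le_trans _ _ (1 * (2 * hnorm (P := test_problem) chi))).
  by apply: ler_pM => //; lra.
by rewrite mul1r.
Qed.

Lemma test_rhsE t psi : test_rhs t psi =
  const_mx (t ^+ k - gated t (ups t) + gated t psi).
Proof.
rewrite /test_rhs; congr const_mx.
have -> : psi - ups t = (-1) *: ups t + psi.
  by rewrite scaleN1r addrC.
by rewrite gated_lin; ring.
Qed.

Lemma test_deriv : let Df := fun t _ chi => const_mx (gated t chi) in
  [/\ is_deriv1 (P := test_problem) X Df, bounded1 (P := test_problem) X Df &
      continuous1 (P := test_problem) X Df].
Proof.
have hn := abs_row_norm.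
split.
- move=> t psi hpsi; split.
    by move=> a chi1 chi2 _ _; apply/rowP => j; rewrite !mxE gated_lin.
  move=> e e0; exists 1 => // chi _ _ _.
  rewrite /= /abs_row !test_rhsE !mxE.
  have := gated_lin t 1 psi chi; rewrite scale1r mul1r => ->.
  set x := (X in `|X|); have -> : x = 0 by rewrite /x; ring.
  by rewrite normr0 mulr_ge0 ?(ltW e0)// hnorm_ge0.
- exists 2 => t psi _ chi hchi; rewrite /= /abs_row mxE.
  exact: gated_bounded.
- move=> t psi _ e e0; exists 1 => // psi' _ _ chi hchi.
  by rewrite subrr /= /abs_row mxE normr0 mulr_ge0 ?(ltW e0)// hnorm_ge0.
Qed.

Lemma test_rfde : rfde_problem X test_problem.
Proof.
have hn := abs_row_norm.
split.
- exact: test_delay_ge0.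
- exact: hn.
- move=> t psi /= hpsi; split=> //; exists 1 => //.
- move=> t psi hpsi e e0.
  have cg : continuous (fun t : R => t ^+ k - gated t (ups t)).
    move=> x; apply: cvgB; first exact: exprn_continuous.
    apply: (gate_times_continuous
      (D := fun t : R => ups t (- ((1 - q) * clamp t)) 0 0 -
                     ups t (- clamp t) 0 0)).
      by move=> y y0; rewrite clamp_le0// mulr0 subrr.
    have cp (j : R) : continuous (fun t : R => ups t (- (j * clamp t)) 0 0).
      move=> y; rewrite /ups /poly_curve; under eq_fun do rewrite mxE.
      apply: (@continuous_comp _ _ _ (fun t : R => t - j * clamp t) (horner test_poly));
        last exact: continuous_horner.
      by apply: cvgB; [exact: cvg_id|apply: cvgMl_tmp; exact: clamp_continuous].
    move=> y; apply: cvgB; first exact: cp.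
    by have := cp 1; under eq_fun do rewrite mul1r; apply.
  have e4 : 0 < e / 4 by lra.
  have /cvgrPdist_le/(_ _ e4)/nbhs_ballP[d1 /= d10 h1] := cg t.
  have cgt := gated_continuous hpsi.
  have /cvgrPdist_le/(_ _ e4)/nbhs_ballP[d2 /= d20 h2] := cgt t.
  exists (Order.min (Order.min d1 d2) (e / 8)).
    by rewrite !lt_min d10 d20 divr_gt0.
  move=> t' psi' hpsi'; rewrite !lt_min => /andP[/andP[t1 t2] _] /andP[_ hh].
  rewrite /= /abs_row !test_rhsE !mxE.
  have hc : `|t' ^+ k - gated t' (ups t') - (t ^+ k - gated t (ups t))| <= e / 4.
    by rewrite distrC; apply: h1; rewrite /ball /= distrC.
  have hb : `|gated t' psi - gated t psi| <= e / 4.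
    by rewrite distrC; apply: h2; rewrite /ball /= distrC.
  have ha := gated_bounded t' (in_phaseB hpsi' hpsi).
  have dE : gated t' (psi' - psi) = gated t' psi' - gated t' psi.
    have -> : psi' - psi = (-1) *: psi + psi' by rewrite scaleN1r addrC.
    by rewrite gated_lin; ring.
  have -> : t' ^+ k - gated t' (ups t') + gated t' psi' -
      (t ^+ k - gated t (ups t) + gated t psi) =
      gated t' (psi' - psi) + (gated t' psi - gated t psi) +
      (t' ^+ k - gated t' (ups t') - (t ^+ k - gated t (ups t))).
    by rewrite dE; ring.
  apply: le_lt_trans (ler_normD _ _) _.
  have hab := ler_normD (gated t' (psi' - psi)) (gated t' psi - gated t psi).
  apply: (@le_lt_trans _ _ (2 * hnorm (P := test_problem) (psi' - psi) + e / 4 + e / 4)).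
    by apply: lerD => //; apply: le_trans hab _; exact: lerD.
  apply: (@lt_le_trans _ _ (2 * (e / 8) + e / 4 + e / 4)); last by lra.
  by rewrite !ltrD2r ltr_pM2l.
- exists (fun t _ chi => const_mx (gated t chi)); exact: test_deriv.
Qed.

Lemma test_rhs_C2 : rhs_C2 X test_problem.
Proof.
exists (fun t _ chi => const_mx (gated t chi)), (fun _ _ _ _ => 0).
split; first exact: test_deriv.
have z (e : R) chi1 chi2 : 0 <= e ->
    abs_row 0 <= e * hnorm (P := test_problem) chi1 * hnorm (P := test_problem) chi2.
  move=> e0; rewrite /abs_row mxE normr0 !mulr_ge0// hnorm_ge0//;
  exact: abs_row_norm.
split.
- move=> t psi hpsi; split.
  + by move=> chi1 _ a chi2 chi3 _ _; rewrite scaler0 addr0.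
  + by move=> chi2 _ a chi1 chi3 _ _; rewrite scaler0 addr0.
  + move=> e e0; exists 1 => // chi1 _ _ _ chi2 _.
    by rewrite subrr subr0; apply: z => //; exact: ltW.
- by exists 0 => t psi _ chi1 chi2 _ _; exact: z.
- move=> t psi _ e e0; exists 1 => // psi' _ _ chi1 chi2 _ _.
  by rewrite subr0; apply: z => //; exact: ltW.
Qed.

Lemma test_initial : @initial_data R test_problem 0 (poly_curve test_poly)
  (poly_curve test_poly^`() 0).
Proof. by split; [exact: poly_curve_phase|exact: poly_curve_deriv]. Qed.

Lemma test_solution : @is_solution R test_problem 0 (poly_curve test_poly)
  (poly_curve test_poly^`() 0) +oo%E (poly_curve test_poly)
  (poly_curve test_poly^`()).
Proof.
split=> //; first exact: ltry.
  by move=> th _; rewrite add0r.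
move=> t _; split; first exact: ups_phase.
  exact: poly_curve_deriv.
have -> : rhs test_problem t (segment (P := test_problem) (poly_curve test_poly) t) =
    poly_curve test_poly^`()^`() t.
  rewrite /= /test_rhs /poly_curve test_poly_deriv2 hornerXn.
  by rewrite subrr gated0 addr0.
exact: poly_curve_deriv.
Qed.

Lemma test_noncontinuable : @noncontinuable R test_problem 0
  (poly_curve test_poly) (poly_curve test_poly^`() 0) +oo%E (poly_curve test_poly).
Proof. by move=> T u' v'; rewrite ltNge leey. Qed.

Variables (s : nat) (A : 'M[{poly R}]_s) (b b' : 'I_s -> {poly R}) (c : 'I_s -> R).
Hypothesis A0 : forall i j, (A i j).[0] = 0.
Hypothesis c_ge0 : forall i, 0 <= c i.

(** Only the errors of the stage functions perturb the stage values.  For times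
    in [0, 1], where the clamp is the identity, the two delays turn the argument
    [c i * h] into [q * c i * h] and into 0, and at 0 the stage functions are
    exact. *)
Lemma test_errors (p : nat) : uniform_order A b b' c X 5 p ->
  exists2 C : R, 0 <= C & exists2 h0 : R, 0 < h0 &
  forall h, 0 < h -> h <= h0 -> exists2 K : 'I_s -> R,
  (forall i, K i = (c i * h) ^+ k + gate (c i * h) *
    (h ^+ 2 * \sum_(j < s | (j < i)%N) (A i j).[q * c i] * K j
     - (q * c i * h) ^+ k.+2 / (k.+1 * k.+2)%:R)) &
  forall alpha, 0 <= alpha <= 1 ->
  `|h ^+ 2 * \sum_i (b i).[alpha] * K i - (alpha * h) ^+ k.+2 / (k.+1 * k.+2)%:R|
     <= C * h ^+ p.+1 /\
  `|h * \sum_i (b' i).[alpha] * K i - (alpha * h) ^+ k.+1 / k.+1%:R|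
     <= C * h ^+ p.+1.
Proof.
have /andP[q0 q1] := q01.
case=> l _ /(_ test_problem test_rfde test_rhs_C2 0 _ _ _ _ _ test_initial
  test_solution test_noncontinuable).
have pw : piecewiseC l (full_itv test_problem 0 +oo%E) (poly_curve test_poly).
  by move=> x y _; exists [::] => *; exact: poly_curve_classC.
move=> /(_ pw)[h0 [C [C' [h00 C0 C'0 H]]]].
exists (C + C'); first by rewrite addr_ge0// ltW.
have cm0 : 0 < 1 + \sum_i c i by rewrite ltr_pwDl// sumr_ge0.
exists (Order.min h0 (1 + \sum_i c i)^-1); first by rewrite lt_min h00 invr_gt0.
move=> h hp; rewrite le_min => /andP[hh0 hc].
have [K hK hE] := H h hp hh0.
have p0 : test_poly.[0] = 0 by rewrite /test_poly hornerZ hornerXn expr0n mulr0.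
have pE x : test_poly.[x] = x ^+ k.+2 / (k.+1 * k.+2)%:R.
  by rewrite /test_poly hornerZ hornerXn mulrC.
have p'E x : test_poly^`().[x] = x ^+ k.+1 / k.+1%:R.
  by rewrite test_poly_deriv hornerZ hornerXn mulrC.
have p'0 : test_poly^`().[0] = 0 by rewrite p'E expr0n mul0r.
exists (fun i => K i 0 0).
  move=> i; have [_ Ki] := hK i; rewrite add0r in Ki.
  have ch0 : 0 <= c i * h by rewrite mulr_ge0// ltW.
  have ch1 : c i * h <= 1.
    rewrite -(mulVf (lt0r_neq0 cm0)) mulrC; apply: ler_pM => //; first exact: ltW.
    by rewrite (bigD1 i)//= addrCA lerDl addr_ge0// sumr_ge0.
  pose e x := (Defs.stage A (P := test_problem) (poly_curve test_poly)
    (poly_curve test_poly^`() 0) h K i x - poly_curve test_poly x) 0 0.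
  have eE x : 0 <= x -> e (x * h) =
      h ^+ 2 * (\sum_(j < s | (j < i)%N) (A i j).[x] * K j 0 0) - test_poly.[x * h].
    move=> x0; rewrite /e /stage; have [neg|pos] := leP (x * h) 0.
      have -> : x = 0 by apply/eqP; rewrite eq_le x0 -(pmulr_lle0 _ hp) neg.
      rewrite mul0r !mxE subrr p0 big1 ?mulr0 ?subr0// => j _.
      by rewrite A0 mul0r.
    rewrite !mxE p0 p'0 mulr0 !add0r summxE mulfK ?gt_eqF//.
    by congr (_ * _ - _); apply: eq_bigr => j _; rewrite mxE.
  have e0 : e 0 = 0.
    have := eE 0 (lexx _); rewrite mul0r p0 subr0 => ->.
    by rewrite big1 ?mulr0// => j _; rewrite A0 mul0r.
  rewrite {1}Ki /= /test_rhs mxE /gated clamp_id//.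
  have segE (x : R) : (segment (P := test_problem) (Defs.stage A (P := test_problem)
      (poly_curve test_poly) (poly_curve test_poly^`() 0) h K i) (c i * h)
      - ups (c i * h)) x 0 0 = e (c i * h + x) by [].
  rewrite !segE; have -> : c i * h + - ((1 - q) * (c i * h)) = q * c i * h by ring.
  by rewrite subrr e0 subr0 eE ?mulr_ge0// pE.
move=> alpha a01; have [E1 E2] := hE alpha a01.
have hn : 0 <= h ^+ p.+1 by rewrite exprn_ge0// ltW.
split.
  apply: (@le_trans _ _ (C * h ^+ p.+1)); last by apply: ler_wpM2r => //; lra.
  apply: le_trans E1; rewrite /= /abs_row /Defs.eta add0r !mxE p0 p'0 mulr0 !add0r pE.
  rewrite summxE le_eqVlt; apply/orP; left; apply/eqP; congr (`|_ * _ - _|).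
  by apply: eq_bigr => j _; rewrite mxE.
apply: (@le_trans _ _ (C' * h ^+ p.+1)); last by apply: ler_wpM2r => //; lra.
apply: le_trans E2; rewrite /= /abs_row /Defs.eta' add0r !mxE p'0 !add0r p'E.
rewrite summxE le_eqVlt; apply/orP; left; apply/eqP; congr (`|_ * _ - _|).
by apply: eq_bigr => j _; rewrite mxE.
Qed.

End TestProblem.

(** * Necessity of the conditions *)

Section OrderConditions.
Variables (R : realType) (X : phase_space) (s : nat).
Variables (A : 'M[{poly R}]_s) (b b' : 'I_s -> {poly R}) (c : 'I_s -> R).
Hypothesis A0 : forall i j, (A i j).[0] = 0.
Hypothesis c_ge0 : forall i, 0 <= c i.

(** Bounds of the form |x| <= C h for arbitrarily small h are how an order of
    accuracy turns into an algebraic identity. *)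
Lemma eq0_of_small (x C : R) :
  (forall d : R, 0 < d -> exists h, [/\ 0 < h, h <= d & `|x| <= C * h]) -> x = 0.
Proof.
move=> hx; apply/eqP; rewrite -normr_le0; apply/ler_addgt0Pr => e e0.
rewrite add0r; have C1 : 0 < `|C| + 1 by have := normr_ge0 C; lra.
have [h [h0 hd]] := hx _ (divr_gt0 e0 C1).
move=> /le_trans; apply; move: hd; rewrite ler_pdivlMr// => hd.
by have := ler_wpM2r (ltW h0) (ler_norm C); lra.
Qed.

(** Quadrature conditions, from the problems whose right-hand side is a power
    of time. *)
Lemma moment_conditions (p : nat) : uniform_order A b b' c X 5 p ->
  forall alpha, 0 <= alpha <= 1 ->
  (forall k, (k.+1 <= p)%N ->
    \sum_i (b' i).[alpha] * c i ^+ k = alpha ^+ k.+1 / k.+1%:R) /\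
  (forall k, (k.+2 <= p)%N ->
    \sum_i (b i).[alpha] * c i ^+ k = alpha ^+ k.+2 / (k.+1 * k.+2)%:R).
Proof.
move=> hp alpha a01.
have g1 (t : R) : `|(fun=> 0 : R) t| <= 1 by rewrite normr0.
have g2 (t : R) : 0 < t -> {for t, continuous (fun=> 0 : R)}.
  by move=> _; exact: cst_continuous.
have g3 : 0 <= (0 : R) <= 1 by rewrite lexx ler01.
have errors k := test_errors g1 g2 g3 k A0 c_ge0 hp.
have cancel (m : nat) (x C h : R) : (m <= p)%N -> 0 < h -> h <= 1 -> 0 <= C ->
    `|h ^+ m * x| <= C * h ^+ p.+1 -> `|x| <= C * h.
  move=> mp h0 h1 C0; rewrite normrM ger0_norm ?exprn_ge0 ?(ltW h0)//.
  have hm : 0 < h ^+ m by rewrite exprn_gt0.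
  move=> hx; rewrite -(ler_pM2l hm); apply: le_trans hx _.
  have -> : h ^+ m * (C * h) = C * h ^+ m.+1 by rewrite exprSr; ring.
  by apply: ler_wpM2l => //; apply: ler_wiXn2l => //; exact: ltW.
have {}errors k : exists2 C : R, 0 <= C & exists2 h0 : R, 0 < h0 &
    forall h, 0 < h -> h <= h0 ->
    `|h ^+ k.+2 * (\sum_i (b i).[alpha] * c i ^+ k - alpha ^+ k.+2 / (k.+1 * k.+2)%:R)|
       <= C * h ^+ p.+1 /\
    `|h ^+ k.+1 * (\sum_i (b' i).[alpha] * c i ^+ k - alpha ^+ k.+1 / k.+1%:R)|
       <= C * h ^+ p.+1.
  have [C C0 [h0 h00 H]] := errors k.
  exists C => //; exists h0 => // h hh0 hh; have [K hK hE] := H h hh0 hh.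
  have KE i : K i = c i ^+ k * h ^+ k by rewrite hK mul0r addr0 exprMn.
  have S (g : 'I_s -> {poly R}) : \sum_i (g i).[alpha] * K i =
      h ^+ k * \sum_i (g i).[alpha] * c i ^+ k.
    by rewrite mulr_sumr; apply: eq_bigr => i _; rewrite KE; ring.
  have := hE alpha a01; rewrite !S !exprMn.
  set x := \sum_i _; set y := \sum_i _.
  have -> : h ^+ 2 * (h ^+ k * x) - alpha ^+ k.+2 * h ^+ k.+2 / (k.+1 * k.+2)%:R =
    h ^+ k.+2 * (x - alpha ^+ k.+2 / (k.+1 * k.+2)%:R).
    by rewrite !exprS; ring.
  have -> : h * (h ^+ k * y) - alpha ^+ k.+1 * h ^+ k.+1 / k.+1%:R =
    h ^+ k.+1 * (y - alpha ^+ k.+1 / k.+1%:R).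
    by rewrite !exprS; ring.
  by [].
split=> k kp; apply/eqP; rewrite -subr_eq0; apply/eqP;
  have [C C0 [h0 h00 H]] := errors k; apply: (eq0_of_small (C := C)) => d d0;
  exists (Order.min (Order.min h0 d) 1);
  have m0 : 0 < Order.min (Order.min h0 d) 1 by rewrite !lt_min h00 d0 ltr01.
- split=> //; first by rewrite !ge_min lexx orbT.
  apply: (cancel _ _ _ _ kp) => //; first by rewrite ge_min lexx orbT.
  by apply: (H _ m0 _).2; rewrite !ge_min lexx.
- split=> //; first by rewrite !ge_min lexx orbT.
  apply: (cancel _ _ _ _ kp) => //; first by rewrite ge_min lexx orbT.
  by apply: (H _ m0 _).1; rewrite !ge_min lexx.
Qed.

(** A product of sines in the logarithm of time, one for each positive abscissa
    other than [c0] and vanishing there.  By periodicity its values at the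
    stage times recur along a sequence of step sizes tending to 0. *)
Lemma gate_exists (c0 : R) : 0 < c0 -> exists gate : R -> R,
  [/\ forall t, `|gate t| <= 1,
      forall t, 0 < t -> {for t, continuous gate} &
      exists2 kappa : R, kappa != 0 & forall d : R, 0 < d -> exists h,
        [/\ 0 < h, h <= d, gate (c0 * h) = kappa &
            forall i, 0 < c i -> c i != c0 -> gate (c i * h) = 0]].
Proof.
move=> c00.
(* L is so large that at c0 the arguments of the sines lie in ]-pi, pi[; they
   are nonzero. *)
pose L := 1 + \sum_i `|ln c0 - ln (c i)|.
have L0 : 0 < L by rewrite ltr_pwDl// sumr_ge0.
pose Q := [pred i | (0 < c i) && (c i != c0)].
pose gate t := \prod_(i < s | Q i) sin ((ln t - ln (c i)) / L).
exists gate; split.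
- move=> t; rewrite /gate normr_prod; apply: prodr_ile1 => i _.
  by rewrite normr_ge0 sin_max.
- move=> t t0; rewrite /gate; apply: cvg_big => [|i _].
    exact: mul_continuous.
  apply: (@continuous_comp _ _ _ (fun t => (ln t - ln (c i)) / L) sin);
    last exact: continuous_sin.
  by apply: cvgMr_tmp; apply: cvgB; [exact: continuous_ln|exact: cvg_cst].
exists (gate c0).
  apply/prodf_neq0 => i /andP[ci cic].
  set x := _ / L.
  have x1 : `|x| < pi.
    apply: (@lt_le_trans _ _ 1); last by have := pi_ge2 R; lra.
    rewrite /x normrM normfV [`|L|]gtr0_norm// ltr_pdivrMr// mul1r.
    rewrite /L (bigD1 i)//=; have : 0 <= \sum_(j < s | j != i) `|ln c0 - ln (c j)|.
      by apply: sumr_ge0.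
    by lra.
  have x0 : x != 0.
    rewrite /x mulf_eq0 invr_eq0 (gt_eqF L0) orbF subr_eq0.
    by apply: contra cic => /eqP/ln_inj ->; rewrite ?posrE.
  move: x1; rewrite ltr_norml => /andP[x1 x2]; move: x0; rewrite neq_lt => /orP[xn|xp].
    by rewrite -[x]opprK sinN oppr_eq0 gt_eqF// sin_gt0_pi//; lra.
  by rewrite gt_eqF// sin_gt0_pi// xp.
(* The step sizes exp (- 2 pi L n) shift ln t by multiples of the period. *)
move=> d d0; pose n := Num.bound d^-1.
have hn : d^-1 < n%:R by apply: archi_boundP; rewrite invr_ge0 ltW.
have T1 : 1 <= L * (pi *+ 2).
  rewrite -[1]mulr1; apply: ler_pM => //; first by rewrite lerDl sumr_ge0.
  by rewrite mulr2n; have := pi_ge2 R; lra.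
pose y := L * (pi *+ 2 *+ n); exists (expR (- y)).
have shift (x z : R) : 0 < x -> sin ((ln (x * expR (- y)) - z) / L) = sin ((ln x - z) / L).
  move=> x0; rewrite lnM ?posrE ?expR_gt0// expRK.
  have -> : (ln x - z) / L = (ln x + - y - z) / L + pi *+ 2 *+ n.
    by rewrite /y; field; rewrite gt_eqF.
  by rewrite (periodicn (@sinD2pi R)).
split.
- exact: expR_gt0.
- rewrite expRN -[leRHS]invrK lef_pV2 ?posrE ?expR_gt0 ?invr_gt0//.
  apply: le_trans (ltW hn) _; apply: le_trans (expR_ge1Dx y).
  have -> : y = L * (pi *+ 2) * n%:R by rewrite /y -[_ *+ n]mulr_natr mulrA.
  have : n%:R <= L * (pi *+ 2) * n%:R by rewrite -[leLHS]mul1r ler_wpM2r.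
  by lra.
- by apply: eq_bigr => i _; rewrite shift.
move=> i ci cic; rewrite /gate (bigD1 i) /=; last by rewrite ci cic.
by rewrite shift// subrr mul0r sin0 mul0r.
Qed.


(** The stage values of a gated problem with third derivative 1 are those of
    the solution up to the size of the stage errors, uniformly in the gate. *)
Lemma gated_stage_values (q : R) : 0 <= q <= 1 ->
  exists2 C : R, 0 <= C & forall (gate : R -> R) h (K : 'I_s -> R),
  (forall t, `|gate t| <= 1) -> 0 < h -> h <= 1 ->
  (forall i, K i = (c i * h) ^+ 1 + gate (c i * h) *
    (h ^+ 2 * \sum_(j < s | (j < i)%N) (A i j).[q * c i] * K j
     - (q * c i * h) ^+ 3 / 6)) ->
  forall i, `|K i - c i * h| <= C * h ^+ 3.
Proof.
move=> /andP[q0 q1]; pose cm := 1 + \sum_i c i.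
have cm0 : 0 <= cm by rewrite addr_ge0// sumr_ge0.
have cle i : c i <= cm.
  by rewrite /cm (bigD1 i)//= addrCA lerDl addr_ge0// sumr_ge0.
have qcle i : 0 <= q * c i <= cm.
  by rewrite mulr_ge0//=; apply: le_trans (cle i); rewrite ler_piMl.
have [Ma Ma0 hMa] := poly_family_bounded (fun ij : 'I_s * 'I_s => A ij.1 ij.2) cm0.
clearbody cm.
suff H n : exists2 C : R, 0 <= C & forall (gate : R -> R) h (K : 'I_s -> R),
  (forall t, `|gate t| <= 1) -> 0 < h -> h <= 1 ->
  (forall i, K i = (c i * h) ^+ 1 + gate (c i * h) *
    (h ^+ 2 * \sum_(j < s | (j < i)%N) (A i j).[q * c i] * K j
     - (q * c i * h) ^+ 3 / 6)) ->
  forall i : 'I_s, (i < n)%N -> `|K i - c i * h| <= C * h ^+ 3.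
  have [C C0 hC] := H s; exists C => // gate h K g h0 h1 hK i.
  exact: (hC gate h K g h0 h1 hK).
elim: n => [|n [C C0 IH]]; first by exists 0.
exists (s%:R * (Ma * (cm + C)) + cm ^+ 3).
  by rewrite addr_ge0 ?exprn_ge0// !mulr_ge0// addr_ge0.
move=> gate h K g h0 h1 hK i; rewrite ltnS => iN.
have hn m : 0 <= h ^+ m by rewrite exprn_ge0// ltW.
have {}IH (j : 'I_s) : (j < i)%N -> `|K j| <= (cm + C) * h.
  move=> ji; have := IH gate h K g h0 h1 hK j (leq_trans ji iN).
  have : h ^+ 3 <= h by rewrite -[leRHS]expr1; apply: ler_wiXn2l => //; exact: ltW.
  move=> /(ler_wpM2l C0) h3 hj; have -> : K j = (K j - c j * h) + c j * h by ring.
  apply: le_trans (ler_normD _ _) _; rewrite [`|c j * h|]ger0_norm.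
    by have := ler_wpM2r (ltW h0) (cle j); lra.
  by rewrite mulr_ge0// ltW.
rewrite {1}hK expr1 addrAC subrr add0r normrM.
apply: le_trans (ler_piMl (normr_ge0 _) (g _)) _.
apply: le_trans (ler_normB _ _) _; rewrite mulrDl; apply: lerD.
  rewrite normrM ger0_norm//.
  have -> : s%:R * (Ma * (cm + C)) * h ^+ 3 = h ^+ 2 * (s%:R * (Ma * ((cm + C) * h))).
    by ring.
  apply: ler_wpM2l => //; apply: le_trans (ler_norm_sum _ _ _) _.
  apply: (@le_trans _ _ (\sum_(j < s) Ma * ((cm + C) * h))); last first.
    by rewrite sumr_const card_ord -[_ *+ s]mulr_natl.
  rewrite [leLHS]big_mkcond; apply: ler_sum => j _; case: ifP => [ji|_].
    rewrite normrM; apply: ler_pM => //; last exact: IH.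
    by apply: (hMa (i, j)); have /andP[? ?] := qcle i; rewrite ger0_norm.
  by rewrite !mulr_ge0 ?addr_ge0// ltW.
have /andP[qc0 qc1] := qcle i.
have p0 : 0 <= q * c i * h by rewrite mulr_ge0// ltW.
rewrite ger0_norm; last by rewrite divr_ge0// exprn_ge0.
apply: (@le_trans _ _ ((q * c i * h) ^+ 3)).
  by rewrite ler_pdivrMr// ler_peMr ?exprn_ge0//; lra.
rewrite -exprMn; apply: lerXn2r; rewrite ?nnegrE ?mulr_ge0 ?(ltW h0)//.
by rewrite ler_pM2r.
Qed.

Hypothesis A_lower : forall i j : 'I_s, (i <= j)%N -> A i j = 0.

(** The error of a gated problem singles out the stages with a given abscissa,
    and its delay the point beta of their error functions. *)
Lemma stage_condition : uniform_order A b b' c X 5 4 ->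
  forall alpha beta i0, 0 <= alpha <= 1 -> 0 <= beta <= c i0 ->
  \sum_(i < s | c i == c i0) (b' i).[alpha] *
    (\sum_(j < s) (A i j).[beta] * c j - beta ^+ 3 / 6) = 0.
Proof.
move=> order4 alpha beta i0 a01 /andP[b0 b1].
have restrict (i : 'I_s) (x : R) : \sum_(j < s | (j < i)%N) (A i j).[x] * c j =
    \sum_(j < s) (A i j).[x] * c j.
  rewrite big_mkcond; apply: eq_bigr => j _.
  by case: ltnP => // ij; rewrite A_lower// horner0 mul0r.
have [c00|c0n] := eqVneq (c i0) 0.
  have -> : beta = 0 by apply/eqP; rewrite eq_le b0 -[X in _ <= X]c00 b1.
  rewrite big1// => i _; rewrite expr0n mul0r subr0 big1 ?mulr0// => j _.
  by rewrite A0 mul0r.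
have c0p : 0 < c i0 by rewrite lt_def c0n c_ge0.
pose q := beta / c i0.
have q01 : 0 <= q <= 1 by rewrite divr_ge0//= ler_pdivrMr// mul1r.
have qc : q * c i0 = beta by rewrite /q divfK.
have [gate [g1 g2 [kappa kappa0 gh]]] := gate_exists c0p.
have [CK CK0 hCK] := gated_stage_values q01.
have [C C0 [h0 h00 H]] := test_errors g1 g2 q01 1 A0 c_ge0 order4.
have [/(_ 1%N isT) moment _] := moment_conditions order4 a01.
have cm0 : 0 <= 1 + \sum_i c i by rewrite addr_ge0// sumr_ge0.
have [Ma Ma0 hMa] := poly_family_bounded (fun ij : 'I_s * 'I_s => A ij.1 ij.2) cm0.
have qcle i : `|q * c i| <= 1 + \sum_i c i.
  have /andP[q0 q1] := q01; rewrite ger0_norm; last exact: mulr_ge0.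
  apply: (@le_trans _ _ (c i)); first by rewrite ler_piMl.
  by rewrite (bigD1 i)//= addrCA lerDl addr_ge0// sumr_ge0.
set S := \sum_(i < s | c i == c i0) _.
have SE : S = \sum_(i < s | c i == c i0) (b' i).[alpha] *
    (\sum_(j < s | (j < i)%N) (A i j).[q * c i] * c j - (q * c i) ^+ 3 / 6).
  by apply: eq_bigr => i /eqP ci; rewrite restrict ci qc.
pose B := \sum_i `|(b' i).[alpha]|.
have B0 : 0 <= B by apply: sumr_ge0.
pose C' := C + `|kappa| * (B * (s%:R * (Ma * CK))).
suff : kappa * S = 0 by move=> /eqP; rewrite mulf_eq0 (negPf kappa0) => /eqP.
apply: (eq0_of_small (C := C')) => d d0.
have m0 : 0 < Order.min (Order.min h0 d) 1 by rewrite !lt_min h00 d0 ltr01.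
have [h [hp]] := gh _ m0; rewrite !le_min => /andP[/andP[hh0 hd] h1] gk gz.
exists h; split=> //.
have [K hK hE] := H h hp hh0.
have hK3 i : K i = (c i * h) ^+ 1 + gate (c i * h) *
    (h ^+ 2 * \sum_(j < s | (j < i)%N) (A i j).[q * c i] * K j
     - (q * c i * h) ^+ 3 / 6) by exact: hK.
have {hE} [_ hE] := hE alpha a01.
have dev := hCK gate h K g1 hp h1 hK3.
pose e (i : 'I_s) := h ^+ 2 * \sum_(j < s | (j < i)%N) (A i j).[q * c i] * K j
     - (q * c i * h) ^+ 3 / 6.
pose T := \sum_(i < s | c i == c i0) (b' i).[alpha] * e i.
have E1 : h * \sum_i (b' i).[alpha] * K i - (alpha * h) ^+ 2 / 2 = h * (kappa * T).
  have -> : \sum_i (b' i).[alpha] * K i =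
      h * \sum_i (b' i).[alpha] * c i ^+ 1 + kappa * T.
    rewrite /T [X in kappa * X]big_mkcond !mulr_sumr -big_split; apply: eq_bigr => i _ /=.
    rewrite hK3 -/(e i) mulrDr; congr (_ + _); first by ring.
    case: eqP => [ci|/eqP cn]; first by rewrite ci gk; ring.
    have [ci|cip] := eqVneq (c i) 0; last first.
      by rewrite gz ?mul0r ?mulr0// lt_def cip c_ge0.
    rewrite /e ci mulr0 mul0r expr0n mul0r subr0 big1 ?mulr0// => j _.
    by rewrite A0 mul0r.
  by rewrite moment; field.
rewrite E1 normrM gtr0_norm// in hE.
have {}hE : `|kappa * T| <= C * h ^+ 4.
  by rewrite -(ler_pM2l hp); apply: le_trans hE _; rewrite exprS mulrCA.
have E2 : `|T - h ^+ 3 * S| <= B * (s%:R * (Ma * CK)) * h ^+ 4.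
  have -> : T - h ^+ 3 * S = \sum_(i < s | c i == c i0) (b' i).[alpha] *
      (h ^+ 2 * \sum_(j < s | (j < i)%N) (A i j).[q * c i] * (K j - c j * h)).
    rewrite SE /T mulr_sumr -sumrB; apply: eq_bigr => i _.
    have -> : \sum_(j < s | (j < i)%N) (A i j).[q * c i] * (K j - c j * h) =
        \sum_(j < s | (j < i)%N) (A i j).[q * c i] * K j -
        h * \sum_(j < s | (j < i)%N) (A i j).[q * c i] * c j.
      by rewrite mulr_sumr -sumrB; apply: eq_bigr => j _; ring.
    by rewrite /e; ring.
  apply: le_trans (ler_norm_sum _ _ _) _.
  rewrite -mulrA /B mulr_suml big_mkcond; apply: ler_sum => i _.
  have pos : 0 <= s%:R * (Ma * CK) * h ^+ 4.
    by rewrite mulr_ge0 ?exprn_ge0 ?(ltW hp)// !mulr_ge0.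
  case: ifP => _; last by rewrite mulr_ge0.
  rewrite normrM; apply: ler_wpM2l => //; rewrite normrM ger0_norm; last first.
    by rewrite exprn_ge0// ltW.
  have h54 : h ^+ 5 <= h ^+ 4 by apply: ler_wiXn2l => //; exact: ltW.
  apply: (@le_trans _ _ (s%:R * (Ma * CK) * h ^+ 5)); last first.
    by apply: ler_wpM2l h54; rewrite !mulr_ge0.
  have -> : s%:R * (Ma * CK) * h ^+ 5 = h ^+ 2 * (s%:R * (Ma * (CK * h ^+ 3))) by ring.
  apply: ler_wpM2l; first by rewrite exprn_ge0// ltW.
  apply: le_trans (ler_norm_sum _ _ _) _.
  apply: (@le_trans _ _ (\sum_(j < s) Ma * (CK * h ^+ 3))); last first.
    by rewrite sumr_const card_ord -[_ *+ s]mulr_natl.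
  rewrite [leLHS]big_mkcond; apply: ler_sum => j _; case: ifP => [ji|_].
    by rewrite normrM; apply: ler_pM => //; exact: (hMa (i, j)).
  apply: mulr_ge0 => //; apply: mulr_ge0 => //; apply: exprn_ge0.
  exact: ltW.
have h3 : 0 < h ^+ 3 by rewrite exprn_gt0.
rewrite -(ler_pM2l h3).
have -> : h ^+ 3 * `|kappa * S| = `|kappa * T - kappa * (T - h ^+ 3 * S)|.
  by rewrite -[X in X * _ = _](gtr0_norm h3) -normrM; congr (`|_|); ring.
apply: le_trans (ler_normB _ _) _; rewrite normrM [leLHS]addrC normrM.
have := ler_wpM2l (normr_ge0 kappa) E2; move: hE; rewrite normrM /C'.
have -> : h ^+ 3 * ((C + `|kappa| * (B * (s%:R * (Ma * CK)))) * h) =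
  C * h ^+ 4 + `|kappa| * (B * (s%:R * (Ma * CK)) * h ^+ 4) by ring.
by lra.
Qed.

End OrderConditions.

(** * Characterisation of uniform order four *)

Theorem theorem3 (R : realType) (X : phase_space) (s : nat)
    (A : 'M[{poly R}]_s) (b b' : 'I_s -> {poly R}) (c : 'I_s -> R)
    (sstar : nat) (cstar : 'I_sstar -> R)
    (hmethod : explicit_fcrkn A b b' c)
    (hb' : forall alpha : R, 0 <= alpha <= 1 ->
       \sum_(i < s) (b' i).[alpha] = alpha)
    (hb : forall alpha : R, 0 <= alpha <= 1 ->
       \sum_(i < s) (b i).[alpha] = alpha ^+ 2 / 2)
    (hA : forall (i : 'I_s) (alpha : R), 0 <= alpha <= c i ->
       \sum_(j < s) (A i j).[alpha] = alpha ^+ 2 / 2)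
    (hcstar_lt : forall m n : 'I_sstar, (m < n)%N -> cstar m < cstar n)
    (hcstar_val : forall x : R,
       (exists m : 'I_sstar, cstar m = x) <-> (exists i : 'I_s, c i = x))
    (horder3 : uniform_order A b b' c X 5 3) :
  uniform_order A b b' c X 5 4 <->
  [/\ forall alpha : R, 0 <= alpha <= 1 ->
        \sum_(i < s) (b' i).[alpha] * c i ^+ 3 = alpha ^+ 4 / 4,
      forall (alpha beta : R) (m : 'I_sstar),
        0 <= alpha <= 1 -> 0 <= beta <= cstar m ->
        \sum_(i < s | c i == cstar m)
          (b' i).[alpha] *
          (\sum_(j < s) (A i j).[beta] * c j - beta ^+ 3 / 6) = 0
    & forall alpha : R, 0 <= alpha <= 1 ->
        \sum_(i < s) (b i).[alpha] * c i ^+ 2 = alpha ^+ 4 / 12].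
Proof.
have [A_lower A0 _ _ c_ge0] := hmethod.
split=> [order4|[cond1 cond2 cond3]].
  split=> [alpha a01|alpha beta m a01 hbeta|alpha a01].
  - by have [/(_ 3%N isT)] := moment_conditions A0 c_ge0 order4 a01.
  - have [i0 ci0] := (hcstar_val (cstar m)).1 (ex_intro _ m erefl).
    by rewrite -ci0 in hbeta *; exact: (stage_condition A0 c_ge0 A_lower order4).
  - by have [_ /(_ 2%N isT)] := moment_conditions A0 c_ge0 order4 a01.
have [l3 l35 H3] := horder3.
exists (maxn 6 l3); first by rewrite leq_max.
move=> P hP hC2 sigma phi v0 tbar u v hini hsol hnon hpw.
have [r0 hN hopen _ _] := hP.
have [Df [D2f [[hDf hDfb _] [hD2f hD2fb _]]]] := hC2.
have L6 := leq_maxl 6 l3.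
have [D D0 [w [w_deriv w_cont w_sol w0u w12]]] :=
  smooth_start hN r0 hsol (leq_trans (isT : 2 <= 6)%N L6) hpw.
apply: (order_four_bound hN r0 hsol hini.1 hopen A_lower c_ge0 hA D0
  L6 w_deriv w_cont w_sol w0u w12 hDf hDfb hD2f hD2fb).
- move=> k alpha a01; have [hm _] := moment_conditions A0 c_ge0 horder3 a01.
  have [k3|k3] := ltnP k 3; first exact: hm.
  have -> : k = 3%N :> nat by apply/eqP; rewrite eqn_leq k3 -ltnS ltn_ord.
  exact: cond1.
- move=> k alpha a01; have [_ hm] := moment_conditions A0 c_ge0 horder3 a01.
  have [k2|k2] := ltnP k 2; first exact: hm.
  have -> : k = 2%N :> nat by apply/eqP; rewrite eqn_leq k2 -ltnS ltn_ord.
  exact: cond3.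
- move=> alpha a01 i0 x hx.
  have [m cm] := (hcstar_val (c i0)).2 (ex_intro _ i0 erefl).
  by rewrite -cm in hx *; exact: cond2.
(* Applicability with small step sizes is part of having an order. *)
have [h1 [C [C' [h10 _ _ H]]]] := H3 P hP hC2 sigma phi v0 tbar u v hini hsol
  hnon (piecewiseC_le (leq_maxr 6 l3) hpw).
by exists h1 => // h h0 hh; have [K hK _] := H h h0 hh; exists K.
Qed.
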